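(* Assume $ef>1$ and $q>3$. Then there exists a representation $M$ of $G$ over $\overline{\mathbb F}_p$ such that $$\pi_0^{I(1)}\otimes_{\mathcal H}\mathrm{ind}_{I(1)Z}^G\mathbf 1\ \simeq\ \pi_0\oplus M$$ as representations of $G$.
   Context: Let $p$ be a prime and $F$ a finite extension of $\mathbb Q_p$ with ramification index $e$, residue degree $f$, ring of integers $\mathcal O$, uniformizer $\varpi$ and residue field $\mathbb F_q$, $q=p^f$. Let $G=\mathrm{GL}_2(F)$, $Z$ its center, $K=\mathrm{GL}_2(\mathcal O)$, and $I(1)\subset K$ the pro-$p$-Iwahori subgroup of matrices that are upper triangular unipotent mod $\varpi$. For $x\in\mathbb F_q$, $[x]\in\mathcal O$ is its multiplicative (Teichmüller) representative, and $I_1=\{[x]:x\in\mathbb F_q\}$. All representations are over $\overline{\mathbb F}_p$ and $\mathrm{ind}$ denotes compact induction; $[g,1]$ denotes the characteristic function of the coset of $g$ and $h\cdot[g,1]=[hg,1]$. Let $\sigma_0$ be the trivial representation of $KZ$. The spherical Hecke operator $T$ on $\mathrm{ind}_{KZ}^G\sigma_0$ is the $G$-equivariant operator $T[g,1]=\sum_{\lambda\in I_1}\left[g\begin{pmatrix}\varpi&\lambda\\0&1\end{pmatrix},1\right]+\left[g\begin{pmatrix}1&0\\0&\varpi\end{pmatrix},1\right]$. The universal supersingular representation is $\pi_0=\mathrm{ind}_{KZ}^G\sigma_0/\mathrm{Im}\,T$ (on which $Z$ acts trivially). The pro-$p$-Iwahori-Hecke algebra is $\mathcal H=\mathrm{End}_G(\mathrm{ind}_{I(1)Z}^G\mathbf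 1)$, where $\mathbf 1$ is the trivial character of $I(1)Z$; it acts on the left on $\mathrm{ind}_{I(1)Z}^G\mathbf 1$. By Frobenius reciprocity $\pi_0^{I(1)}=\mathrm{Hom}_G(\mathrm{ind}_{I(1)Z}^G\mathbf 1,\pi_0)$ (with $v$ corresponding to $[g,1]\mapsto g\cdot v$), and $\mathcal H$ acts on the right on it by precomposition. The group $G$ acts on $\pi_0^{I(1)}\otimes_{\mathcal H}\mathrm{ind}_{I(1)Z}^G\mathbf 1$ through the second factor. *)

(* Defs.v *)
From HB Require Import structures.
From mathcomp Require Import all_boot all_algebra all_field.
From mathcomp Require Import boolp classical_sets functions cardinality fsbigop.
Set Implicit Arguments.
Unset Strict Implicit.
Unset Printing Implicit Defensive.
Import GRing.Theory.
Local Open Scope ring_scope.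

(* Z_p is the inverse limit of the rings Z / p^n: an element is a sequence
   of integers x with x n the least non-negative residue of x n.+1 mod p^n. *)
Definition coherent (p : nat) (x : nat -> int) : Prop :=
  forall n, x n = (x n.+1 %% (p ^ n)%N)%Z.

(* The primality proof is a parameter so that the integral domain structure
   below can be inferred. *)
Record padic_int (p : nat) (p_pr : prime p) := PadicInt {
  padic_seq : nat -> int;
  _ : `[< coherent p padic_seq >]
}.

Section PadicIntegers.
Variables (p : nat) (p_pr : prime p).

Local Notation pX n := (Posz (p ^ n)).
Local Notation coherent := (coherent p).
Local Notation padic_int := (padic_int p_pr).

HB.instance Definition _ := [isSub of padic_int for @padic_seq p p_pr].
HB.instance Definition _ := [Choice of padic_int by <:].

Lemma modz_dvdm d m a : (d %| m)%Z -> ((a %% m)%Z = a %[mod d])%Z.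
Proof.
move=> dm; apply/eqP; rewrite eqz_mod_dvd {2}(divz_eq a m) opprD addrCA subrr.
by rewrite addr0 rpredN dvdz_mull.
Qed.

Lemma padic_coherent (x : padic_int) : coherent (val x).
Proof. exact/asboolP/(valP x). Qed.

Lemma padic_mod (x : padic_int) m n :
  (m <= n)%N -> (val x n = val x m %[mod pX m])%Z.
Proof.
move=> /subnK <-; elim: (n - m)%N => //= k IH.
rewrite addSn -IH (padic_coherent x (k + m)).
by rewrite expnD PoszM mulrC modz_dvdm // dvdz_mulr.
Qed.

Lemma padic_small (x : padic_int) n : (val x n %% pX n)%Z = val x n.
Proof. by rewrite (padic_coherent x n) modz_mod. Qed.

Lemma padic_eq (x y : padic_int) :
  (forall n, val x n = val y n %[mod pX n])%Z -> x = y.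
Proof.
move=> xy; apply/val_inj/funext => n.
by rewrite -padic_small xy padic_small.
Qed.

Definition compatible (y : nat -> int) : Prop :=
  forall n, (y n.+1 = y n %[mod pX n])%Z.

Lemma padic_of_subproof y :
  compatible y -> `[< coherent (fun n => (y n %% pX n)%Z) >].
Proof.
move=> yc; apply/asboolP => n /=.
by rewrite -yc expnS PoszM modz_dvdm // dvdz_mull.
Qed.

Definition padic_of y (yc : compatible y) : padic_int :=
  PadicInt p_pr (padic_of_subproof yc).

Lemma padic_ofE y (yc : compatible y) n :
  (val (padic_of yc) n = y n %[mod pX n])%Z.
Proof. by rewrite /= modz_mod. Qed.

Lemma padic_compat (x : padic_int) : compatible (val x).
Proof. by move=> n; apply: padic_mod. Qed.

Lemma compat_cst c : compatible (fun=> c).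
Proof. by []. Qed.
Lemma compat_add (x y : padic_int) : compatible (fun n => val x n + val y n).
Proof. by move=> n; rewrite -modzDm !padic_compat modzDm. Qed.
Lemma compat_opp (x : padic_int) : compatible (fun n => - val x n).
Proof. by move=> n; rewrite -modzNm padic_compat modzNm. Qed.
Lemma compat_mul (x y : padic_int) : compatible (fun n => val x n * val y n).
Proof. by move=> n; rewrite -modzMm !padic_compat modzMm. Qed.

Definition padic_add x y := padic_of (compat_add x y).
Definition padic_opp x := padic_of (compat_opp x).
Definition padic_mul x y := padic_of (compat_mul x y).
Definition padic_zero := padic_of (compat_cst 0).
Definition padic_one := padic_of (compat_cst 1).

Fact padic_addA : associative padic_add.
Proof.
by move=> x y z; apply: padic_eq => n; rewrite /= !modz_mod modzDml modzDmr addrA.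
Qed.
Fact padic_addC : commutative padic_add.
Proof. by move=> x y; apply: padic_eq => n; rewrite /= addrC. Qed.
Fact padic_add0 : left_id padic_zero padic_add.
Proof.
by move=> x; apply: padic_eq => n; rewrite /= mod0z add0r modz_mod.
Qed.
Fact padic_addN : left_inverse padic_zero padic_opp padic_add.
Proof.
by move=> x; apply: padic_eq => n; rewrite /= modzDml addNr.
Qed.

HB.instance Definition _ :=
  GRing.isZmodule.Build padic_int padic_addA padic_addC padic_add0 padic_addN.

Fact padic_mulA : associative padic_mul.
Proof.
by move=> x y z; apply: padic_eq => n; rewrite /= !modz_mod modzMml modzMmr mulrA.
Qed.
Fact padic_mulC : commutative padic_mul.
Proof. by move=> x y; apply: padic_eq => n; rewrite /= mulrC. Qed.
Fact padic_mul1 : left_id padic_one padic_mul.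
Proof.
by move=> x; apply: padic_eq => n; rewrite /= modz_mod modzMml mul1r.
Qed.
Fact padic_mulD : left_distributive padic_mul padic_add.
Proof.
move=> x y z; apply: padic_eq => n.
by rewrite /= !modz_mod modzMml modzDm mulrDl.
Qed.
Fact padic_one_neq0 : padic_one != padic_zero.
Proof.
apply/eqP => /(congr1 (fun x : padic_int => val x 1%N)) /=.
by rewrite expn1 mod0z modz_small // ltz_nat prime_gt1.
Qed.

HB.instance Definition _ := GRing.Zmodule_isComNzRing.Build padic_int
  padic_mulA padic_mulC padic_mul1 padic_mulD padic_one_neq0.

Definition padic_unit : {pred padic_int} :=
  [pred x | `[< exists y, y * x = 1 >]].
Definition padic_inv (x : padic_int) : padic_int :=
  if pselect (exists y, y * x = 1) is left ex then projT1 (cid ex) else x.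

Fact padic_mulV : {in padic_unit, left_inverse 1 padic_inv *%R}.
Proof.
move=> x /asboolP ux; rewrite /padic_inv; case: pselect => // ex.
by case: cid.
Qed.
Fact padic_unitP x y : y * x = 1 -> padic_unit x.
Proof. by move=> yx; apply/asboolP; exists y. Qed.
Fact padic_inv_out : {in [predC padic_unit], padic_inv =1 id}.
Proof.
by move=> x /asboolPn nux; rewrite /padic_inv; case: pselect.
Qed.

HB.instance Definition _ := GRing.ComNzRing_hasMulInverse.Build padic_int
  padic_mulV padic_unitP padic_inv_out.

Lemma padic_neq0 (x : padic_int) : x != 0 -> exists n, ~~ (pX n %| val x n)%Z.
Proof.
move=> x0; apply: contrapT => nex; move/eqP: x0; apply; apply: padic_eq => n.
rewrite /= modz_mod mod0z; apply/dvdz_mod0P; apply: contrapT => /negP nd.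
by apply: nex; exists n.
Qed.

Fact padic_integral : GRing.integral_domain_axiom padic_int.
Proof.
move=> x y xy0; apply: contrapT => /negP; rewrite negb_or => /andP[].
move=> /padic_neq0[n xn] /padic_neq0[m ym].
have lt_log (z : padic_int) i j : ~~ (pX i %| val z i)%Z -> (i <= j)%N ->
    (0 < `|val z j|)%N && (logn p `|val z j| < i)%N.
  move=> zi ij; have [z0|z0] := posnP `|val z j|%N.
    case/negP: zi; apply/dvdz_mod0P; rewrite -(padic_mod z ij).
    by move/eqP: z0; rewrite absz_eq0 => /eqP ->; rewrite mod0z.
  rewrite ltnNge -pfactor_dvdn //=; apply: contra zi => d.
  apply/dvdz_mod0P; rewrite -(padic_mod z ij).
  by apply/dvdz_mod0P; rewrite dvdzE.
have /andP[x0 xl] := lt_log x n (n + m)%N xn (leq_addr _ _).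
have /andP[y0 yl] := lt_log y m (n + m)%N ym (leq_addl _ _).
have: (pX (n + m) %| val x (n + m)%N * val y (n + m)%N)%Z.
  apply/dvdz_mod0P.
  have /(congr1 (fun z : padic_int => val z (n + m)%N)) /= := xy0.
  by rewrite mod0z.
rewrite dvdzE abszM pfactor_dvdn ?muln_gt0 ?x0 // lognM // leqNgt => /negP; case.
by rewrite -addSn leq_add // ltnW.
Qed.

HB.instance Definition _ :=
  GRing.ComUnitRing_isIntegral.Build padic_int padic_integral.
End PadicIntegers.

Definition padic (p : nat) (p_pr : prime p) := {fraction padic_int p_pr}.

Record submodule (k : fieldType) (V : lmodType k) := Submodule {
  sub_mem :> {pred V};
  sub_closed : submod_closed sub_mem
}.

HB.instance Definition _ (k : fieldType) (V : lmodType k) (W : submodule V) :=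
  GRing.isSubmodClosed.Build k V (sub_mem W) (GRing.submod_closed_semi (sub_closed W)).

Record subspace (k : fieldType) (V : lmodType k) (W : submodule V) := Subspace {
  sub_val :> V;
  _ : sub_val \in sub_mem W
}.

Section Submodules.
Variables (k : fieldType) (V : lmodType k).
Implicit Type W : submodule V.

HB.instance Definition _ W := [isSub of subspace W for @sub_val k V W].
HB.instance Definition _ W := [Choice of subspace W by <:].
HB.instance Definition _ W := [SubChoice_isSubZmodule of subspace W by <:].
HB.instance Definition _ W := [SubZmodule_isSubLmodule of subspace W by <:].

Fact span_closed (S : V -> Prop) :
  submod_closed [pred v : V |
    `[< forall W, (forall s, S s -> s \in sub_mem W) -> v \in sub_mem W >]].
Proof.
split; first by apply/asboolP => W _; rewrite rpred0.
move=> a u v /asboolP Su /asboolP Sv; apply/asboolP => W SW.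
by rewrite rpredD ?rpredZ ?Su ?Sv.
Qed.
Definition span (S : V -> Prop) : submodule V := Submodule (span_closed S).

Fact image_closed (U : lmodType k) (f : {linear U -> V}) :
  submod_closed [pred v : V | `[< exists u, v = f u >]].
Proof.
split; first by apply/asboolP; exists 0; rewrite linear0.
move=> a _ _ /asboolP[u ->] /asboolP[v ->]; apply/asboolP.
by exists (a *: u + v); rewrite linearP.
Qed.
Definition image U f : submodule V := Submodule (@image_closed U f).

Definition quotient W : Type := Quotient.quot (sub_mem W).
HB.instance Definition _ W := GRing.Zmodule.on (quotient W).

Definition quot_pi W (v : V) : quotient W := \pi_(Quotient.quot (sub_mem W))%qT v.
Definition quot_repr W (x : quotient W) : V := repr (x : Quotient.quot (sub_mem W)).

Lemma quot_piK W (x : quotient W) : quot_pi W (quot_repr x) = x.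
Proof. exact: reprK. Qed.

Lemma quot_piP W (u v : V) : quot_pi W u = quot_pi W v <-> u - v \in sub_mem W.
Proof.
split=> [/eqP|uv]; first by rewrite -Quotient.idealrBE.
by apply/eqP; rewrite -Quotient.idealrBE.
Qed.

Lemma quot_piD W (u v : V) : quot_pi W (u + v) = quot_pi W u + quot_pi W v.
Proof. exact: (raddfD (\pi_(Quotient.quot (sub_mem W)))%qT). Qed.

Definition quot_scale W a (x : quotient W) := quot_pi W (a *: quot_repr x).

Lemma quot_piZ W a v : quot_pi W (a *: v) = quot_scale a (quot_pi W v).
Proof.
apply/quot_piP; rewrite -scalerBr rpredZ //.
by apply/quot_piP; rewrite quot_piK.
Qed.

Fact quot_scaleA W a b (x : quotient W) :
  quot_scale a (quot_scale b x) = quot_scale (a * b) x.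
Proof. by rewrite -(quot_piK x) -!quot_piZ scalerA. Qed.
Fact quot_scale1 W : left_id 1 (@quot_scale W).
Proof. by move=> x; rewrite -(quot_piK x) -!quot_piZ scale1r. Qed.
Fact quot_scaleDr W : right_distributive (@quot_scale W) +%R.
Proof.
move=> a x y; rewrite -(quot_piK x) -(quot_piK y).
by rewrite -quot_piD -!quot_piZ -quot_piD scalerDr.
Qed.
Fact quot_scaleDl W (x : quotient W) :
  {morph (@quot_scale W)^~ x : a b / a + b}.
Proof. by move=> a b; rewrite -(quot_piK x) -!quot_piZ -quot_piD scalerDl. Qed.

HB.instance Definition _ W := GRing.Zmodule_isLmodule.Build k (quotient W)
  (@quot_scaleA W) (@quot_scale1 W) (@quot_scaleDr W) (@quot_scaleDl W).

Fact quot_pi_linear W : linear (quot_pi W).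
Proof. by move=> a u v; rewrite quot_piD quot_piZ. Qed.
HB.instance Definition _ W :=
  GRing.isLinear.Build k V (quotient W) *:%R (quot_pi W) (@quot_pi_linear W).

End Submodules.

Section QuotientMap.
Variables (k : fieldType) (V : lmodType k) (W : submodule V).
Variables (f : {linear V -> V}).
Hypothesis fW : forall v, v \in sub_mem W -> f v \in sub_mem W.

Definition quot_map of forall v, v \in sub_mem W -> f v \in sub_mem W :=
  fun x : quotient W => quot_pi W (f (quot_repr x)).

Lemma quot_mapE v : quot_map fW (quot_pi W v) = quot_pi W (f v).
Proof.
apply/quot_piP; rewrite -linearB; apply/fW/quot_piP.
by rewrite quot_piK.
Qed.

Fact quot_map_linear : linear (quot_map fW).
Proof.
move=> a x y; rewrite -(quot_piK x) -(quot_piK y) -linearP.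
by rewrite !quot_mapE linearP linearP.
Qed.
HB.instance Definition _ := GRing.isLinear.Build k (quotient W) (quotient W)
  *:%R (quot_map fW) quot_map_linear.
End QuotientMap.

Record representation (k : fieldType) (G : groupType) := Representation {
  rep_space :> lmodType k;
  rep_act : G -> {linear rep_space -> rep_space};
  rep_act1 : forall v, rep_act 1%g v = v;
  rep_actM : forall g h v, rep_act (g * h)%g v = rep_act g (rep_act h v)
}.

Record rep_hom (k : fieldType) (G : groupType) (V W : representation k G) :=
  RepHom {
    rep_hom_fun :> {linear V -> W};
    rep_homE : forall g v, rep_hom_fun (rep_act V g v) = rep_act W g (rep_hom_fun v)
  }.

Definition rep_iso (k : fieldType) (G : groupType) (V W : representation k G) :=
  exists f : rep_hom V W, bijective f.

Section Representations.
Variables (k : fieldType) (G : groupType).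
Implicit Types V W : representation k G.

Section DirectSum.
Variables V W : representation k G.
Definition sum_act (g : G) (x : V * W) : V * W :=
  (rep_act V g x.1, rep_act W g x.2).
Fact sum_act_linear g : linear (sum_act g).
Proof. by move=> a x y; rewrite /sum_act !linearP. Qed.
HB.instance Definition _ g := GRing.isLinear.Build k (V * W)%type (V * W)%type
  *:%R (sum_act g) (sum_act_linear g).
Fact sum_act1 x : sum_act 1%g x = x.
Proof. by case: x => v w; rewrite /sum_act !rep_act1. Qed.
Fact sum_actM g h x : sum_act (g * h)%g x = sum_act g (sum_act h x).
Proof. by rewrite /sum_act !rep_actM. Qed.
Definition rep_sum : representation k G :=
  @Representation k G (V * W)%type (fun g => sum_act g) sum_act1 sum_actM.
End DirectSum.

Section Quotient.
Variables (V : representation k G) (W : submodule V).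
Hypothesis stW : forall g v, v \in sub_mem W -> rep_act V g v \in sub_mem W.
Fact quot_act1 (x : quotient W) : quot_map (stW 1%g) x = x.
Proof. by rewrite -(quot_piK x) quot_mapE rep_act1. Qed.
Fact quot_actM g h (x : quotient W) :
  quot_map (stW (g * h)%g) x = quot_map (stW g) (quot_map (stW h) x).
Proof. by rewrite -(quot_piK x) !quot_mapE rep_actM. Qed.
Definition rep_quotient : representation k G :=
  @Representation k G (quotient W) (fun g => quot_map (stW g))
    quot_act1 quot_actM.
End Quotient.

Section Cokernel.
Variables (V W : representation k G) (f : rep_hom V W).
Fact image_stable g w : w \in sub_mem (image f) -> rep_act W g w \in sub_mem (image f).
Proof.
move=> /asboolP[v ->]; apply/asboolP.
by exists (rep_act V g v); rewrite rep_homE.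
Qed.
Definition cokernel : representation k G := rep_quotient image_stable.
End Cokernel.

Section Invariants.
Variables (V : representation k G) (J : {pred G}).
Fact invariants_closed :
  submod_closed [pred v : V | `[< forall g, g \in J -> rep_act V g v = v >]].
Proof.
split; first by apply/asboolP => g _; rewrite linear0.
move=> a u v /asboolP Ju /asboolP Jv; apply/asboolP => g Jg.
by rewrite linearP Ju ?Jv.
Qed.
Definition invariants : submodule V := Submodule invariants_closed.

Lemma invariantsP (v : V) :
  reflect (forall g, g \in J -> rep_act V g v = v) (v \in sub_mem invariants).
Proof. exact: asboolP. Qed.
End Invariants.

(* The functions on G / H, seen as right H-invariant functions on G,
   supported on finitely many cosets.  For H open in G and containing the
   center this is the space of functions with compact support modulo H. *)
Section CompactInduction.
Variable H : groupClosed G.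

Definition cind_cond (f : G -> k) : Prop :=
  (forall g h, h \in H -> f (g * h)%g = f g) /\
  (exists s : seq G, forall g, f g != 0 -> exists2 x, x \in s & (x^-1 * g)%g \in H).

Fact cind_closed : submod_closed [pred f : G -> k^o | `[< cind_cond f >]].
Proof.
split; first by apply/asboolP; split=> //; exists [::] => g; rewrite eqxx.
move=> a u v /asboolP[Hu [s su]] /asboolP[Hv [t tv]]; apply/asboolP; split.
  by move=> g h Hh; congr (a * _ + _); [exact: Hu | exact: Hv].
exists (s ++ t) => g; have [u0|/su[x xs Hx] _] := eqVneq (u g) 0; last first.
  by exists x; rewrite // mem_cat xs.
rewrite (_ : (a *: u + v) g = a * u g + v g) // u0 mulr0 add0r => /tv[x xt Hx].
by exists x; rewrite // mem_cat xt orbT.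
Qed.
Definition cind_fun : submodule (G -> k^o) := Submodule cind_closed.

Lemma cindP (f : subspace cind_fun) : cind_cond (val f).
Proof. exact/asboolP/(valP f). Qed.

Fact translate_subproof (g : G) (f : subspace cind_fun) :
  (fun x => val f (g^-1 * x)%g) \in sub_mem cind_fun.
Proof.
have [Hf [s sf]] := cindP f; apply/asboolP; split=> [x h Hh|].
  by rewrite mulgA Hf.
exists [seq (g * x)%g | x <- s] => x /sf[y ys Hy].
by exists (g * y)%g; rewrite ?map_f // invgM -mulgA.
Qed.
Definition translate g f : subspace cind_fun := Subspace (translate_subproof g f).
Fact translate_linear g : linear (translate g).
Proof. by move=> a u v; apply/val_inj/funext. Qed.
HB.instance Definition _ g := GRing.isLinear.Build k _ _ *:%R (translate g)
  (translate_linear g).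
Fact translate1 f : translate 1%g f = f.
Proof. by apply/val_inj/funext => x; rewrite /= invg1 mul1g. Qed.
Fact translateM g h f : translate (g * h)%g f = translate g (translate h f).
Proof. by apply/val_inj/funext => x; rewrite /= invgM mulgA. Qed.

Definition cind : representation k G :=
  @Representation k G (subspace cind_fun) (fun g => translate g)
    translate1 translateM.

Fact bracket_subproof (g : G) :
  (fun x => ((g^-1 * x)%g \in H)%:R) \in sub_mem cind_fun.
Proof.
apply/asboolP; split=> [x h Hh|]; first by rewrite mulgA gpredMr.
exists [:: g] => x; have [Hx _|] := boolP (_ \in H); last by rewrite eqxx.
by exists g; rewrite ?inE.
Qed.
(* [g, 1], the characteristic function of g H *)
Definition bracket g : cind := Subspace (bracket_subproof g).

Lemma bracket_act g h : rep_act cind g (bracket h) = bracket (g * h)%g.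
Proof. by apply/val_inj/funext => x; rewrite /= invgM mulgA. Qed.
End CompactInduction.
End Representations.

(* The map f |-> \sum_(g H) f(g) g v attached to v, that is, the linear map
   sending [g, 1] to g v when v is fixed by H. *)
Section Frobenius.
Variables (k : fieldType) (G : groupType) (H : groupClosed G).
Variable V : representation k G.
Local Notation cind := (cind k H).

Definition coset_repr (x : G) : G := choose [pred y | (x^-1 * y)%g \in H] x.

Lemma coset_reprP x : (x^-1 * coset_repr x)%g \in H.
Proof.
apply: (@chooseP _ [pred y | (x^-1 * y)%g \in H]).
by rewrite /= mulVg gpred1.
Qed.

Lemma coset_repr_eq x y : (x^-1 * y)%g \in H -> coset_repr x = coset_repr y.
Proof.
move=> Hxy; rewrite /coset_repr.
have eqP : [pred z | (x^-1 * z)%g \in H] =1 [pred z | (y^-1 * z)%g \in H].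
  move=> z /=; rewrite -[in LHS](mulVKg y z) mulgA gpredMl //.
rewrite (eq_choose eqP); apply: choose_id; last by rewrite /= mulVg gpred1.
by rewrite -eqP /= mulVg gpred1.
Qed.

Lemma coset_repr_id x : coset_repr (coset_repr x) = coset_repr x.
Proof. exact/esym/coset_repr_eq/coset_reprP. Qed.

Lemma cind_repr (f : cind) x : val f (coset_repr x) = val f x.
Proof.
by have [Hf _] := cindP f; rewrite -{1}(mulVKg x (coset_repr x)) Hf ?coset_reprP.
Qed.

Definition frob (v : V) (f : cind) : V :=
  \sum_(g \in [set g | coset_repr g = g]) (val f g *: rep_act V g v).

Definition supporting (f : cind) (r : seq G) : Prop :=
  [/\ uniq r, forall x, x \in r -> coset_repr x = x &
      forall x, val f x != 0 -> coset_repr x \in r].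

Lemma supporting_exists (u v : cind) : exists2 r, supporting u r & supporting v r.
Proof.
have [_ [s su]] := cindP u; have [_ [t tv]] := cindP v.
have rr x : x \in undup (map coset_repr (s ++ t)) -> coset_repr x = x.
  by rewrite mem_undup => /mapP[y _ ->]; apply: coset_repr_id.
exists (undup (map coset_repr (s ++ t))); split; rewrite ?undup_uniq //.
  move=> x /su[y ys Hy]; rewrite mem_undup -(coset_repr_eq Hy).
  by apply/map_f; rewrite mem_cat ys.
move=> x /tv[y yt Hy]; rewrite mem_undup -(coset_repr_eq Hy).
by apply/map_f; rewrite mem_cat yt orbT.
Qed.

Lemma frob_seq v f r : supporting f r ->
  frob v f = \sum_(x <- r) (val f x *: rep_act V x v).
Proof.
move=> [ur rr fr]; rewrite /frob -(fsbig_widen [set` r]) -?fsbig_seq //.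
move=> x [/= xx xr]; have [->|/fr] := eqVneq (val f x) 0; first by rewrite scale0r.
by rewrite xx.
Qed.

Fact frob_linear v : linear (frob v).
Proof.
move=> a f1 f2; have [r r1 r2] := supporting_exists f1 f2.
have r12 : supporting (a *: f1 + f2) r.
  case: r1 r2 => [ur rr fr1] [_ _ fr2]; split=> // x.
  have [f10|/fr1//] := eqVneq (val f1 x) 0.
  by rewrite (_ : val _ x = a * val f1 x + val f2 x) // f10 mulr0 add0r => /fr2.
rewrite !(@frob_seq v _ r) // scaler_sumr -big_split /=; apply: eq_bigr => x _.
by rewrite scalerA -scalerDl.
Qed.
HB.instance Definition _ v := GRing.isLinear.Build k cind V *:%R (frob v)
  (frob_linear v).

Lemma cind_expand f r : supporting f r ->
  f = \sum_(x <- r) (val f x *: bracket k H x).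
Proof.
move=> [ur rr fr]; apply/val_inj/funext => y.
rewrite raddf_sum fct_sumE.
have [fy0|/fr yr] := eqVneq (val f y) 0.
  rewrite fy0 big1_seq // => x /andP[_ xr].
  change (val f x * ((x^-1 * y)%g \in H)%:R = 0).
  have [Hx|_] := boolP (_ \in H); last by rewrite mulr0.
  by rewrite -(cind_repr f x) (coset_repr_eq Hx) cind_repr fy0 mul0r.
rewrite (bigD1_seq (coset_repr y)) //= big1_seq ?addr0.
  change (val f y = val f (coset_repr y) * (((coset_repr y)^-1 * y)%g \in H)%:R).
  rewrite cind_repr -[(_^-1 * _)%g]invgK gpredV invgM invgK coset_reprP.
  by rewrite mulr1.
move=> x /andP[xy xr].
change (val f x * ((x^-1 * y)%g \in H)%:R = 0).
have [Hx|_] := boolP (_ \in H); last by rewrite mulr0.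
by rewrite -(coset_repr_eq Hx) rr // eqxx in xy.
Qed.

Lemma frob_bracket v g : v \in sub_mem (invariants V H) ->
  frob v (bracket k H g) = rep_act V g v.
Proof.
move=> /invariantsP Hv; rewrite (@frob_seq v _ [:: coset_repr g]); last first.
  split=> // x; first by rewrite inE => /eqP ->; rewrite coset_repr_id.
  rewrite /= inE; have [Hx _|] := boolP (_ \in H); last by rewrite eqxx.
  by rewrite (coset_repr_eq Hx).
rewrite big_seq1 /= coset_reprP scale1r.
by rewrite -[in LHS](mulVKg g (coset_repr g)) rep_actM Hv ?coset_reprP.
Qed.

Lemma frob_act v g f : v \in sub_mem (invariants V H) ->
  frob v (rep_act cind g f) = rep_act V g (frob v f).
Proof.
move=> Hv; have [r rf _] := supporting_exists f f.
rewrite (cind_expand rf) (linear_sum (rep_act cind g)).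
rewrite !(linear_sum (frob v)) (linear_sum (rep_act V g)).
apply: eq_bigr => x _; rewrite (linearZ_LR (rep_act cind g)) !(linearZ_LR (frob v)).
by rewrite (linearZ_LR (rep_act V g)) /= bracket_act !frob_bracket // rep_actM.
Qed.

Lemma bracket_invariant h : h \in H ->
  rep_act cind h (bracket k H 1%g) = bracket k H 1%g.
Proof.
move=> Hh; rewrite bracket_act mulg1; apply/val_inj/funext => x /=.
by rewrite invg1 mul1g gpredMl ?gpredV.
Qed.

Lemma frob_unique (phi : rep_hom cind V) f :
  frob (phi (bracket k H 1%g)) f = phi f.
Proof.
have [r rf _] := supporting_exists f f.
rewrite (cind_expand rf) (linear_sum phi) (linear_sum (frob _)).
apply: eq_bigr => x _; rewrite (linearZ_LR (frob _)) (linearZ_LR phi) /= frob_bracket -?rep_homE ?bracket_act ?mulg1 //.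
by apply/invariantsP => h Hh; rewrite -rep_homE bracket_invariant.
Qed.
End Frobenius.

Definition hecke_algebra (k : fieldType) (G : groupType) (H : groupClosed G) :=
  rep_hom (cind k H) (cind k H).

(* Under Frobenius reciprocity v corresponds to frob v : cind k H -> V, and
   precomposing with h gives the map sending [1, 1] to frob v (h [1, 1]).
   J and H are separate so as to cover J = I(1) and H = I(1)Z when Z acts
   trivially on V. *)
Section HeckeAction.
Variables (k : fieldType) (G : groupType) (J H : groupClosed G).
Variable V : representation k G.
Hypothesis JH : {subset J <= H}.
Hypothesis VJ : forall v, v \in sub_mem (invariants V J) ->
  v \in sub_mem (invariants V H).

Fact hecke_act_subproof (v : subspace (invariants V J))
    (h : hecke_algebra k H) :
  frob (val v) (h (bracket k H 1%g)) \in sub_mem (invariants V J).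
Proof.
apply/invariantsP => j Jj; rewrite -frob_act; last exact/VJ/valP.
by rewrite -rep_homE bracket_invariant ?JH.
Qed.
Definition hecke_act v h : subspace (invariants V J) :=
  Subspace (hecke_act_subproof v h).

Lemma hecke_actE (phi : rep_hom (cind k H) V) v h :
  val v = phi (bracket k H 1%g) ->
  val (hecke_act v h) = phi (h (bracket k H 1%g)).
Proof. by move=> /= ->; rewrite frob_unique. Qed.
End HeckeAction.

Lemma span_stable (k : fieldType) (V : lmodType k) (S : V -> Prop)
    (f : {linear V -> V}) :
  (forall s, S s -> f s \in sub_mem (span S)) ->
  forall v, v \in sub_mem (span S) -> f v \in sub_mem (span S).
Proof.
move=> fS v /asboolP Sv.
have clW : submod_closed [pred w | f w \in sub_mem (span S)].
  split; first by change (f 0 \in sub_mem (span S)); rewrite linear0 rpred0.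
  move=> a x y fx fy; change (f (a *: x + y) \in sub_mem (span S)).
  by rewrite linearP rpredD // rpredZ.
exact: (Sv (Submodule clW)).
Qed.

Section FreeModule.
Variables (k : fieldType) (T : Type).

Fact finsupp_closed :
  submod_closed [pred f : T -> k^o | `[< finite_set [set x | f x != 0] >]].
Proof.
split.
  by apply/asboolP; apply: sub_finite_set (finite_set0 T) => x /=; rewrite eqxx.
move=> a u v /asboolP fu /asboolP fv; apply/asboolP.
have fuv : finite_set ([set x | u x != 0] `|` [set x | v x != 0])%classic.
  by rewrite finite_setU.
apply: sub_finite_set fuv => x /=; rewrite (_ : (a *: u + v) x = a * u x + v x) //.
by have [->|] := eqVneq (u x) 0; [rewrite mulr0 add0r; right | left].
Qed.
Definition finsupp : submodule (T -> k^o) := Submodule finsupp_closed.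

Definition free_module := subspace finsupp.
HB.instance Definition _ := GRing.Lmodule.on free_module.

Fact delta_subproof t : (fun x => `[< x = t >]%:R : k^o) \in sub_mem finsupp.
Proof.
apply/asboolP; apply: sub_finite_set (finite_set1 t) => x /=.
by case: asboolP => // _; rewrite eqxx.
Qed.
Definition delta t : free_module := Subspace (delta_subproof t).
End FreeModule.

(* A is a right module and B a left module over a k-algebra with carrier X,
   acting through ra and lb; G acts on B commuting with X. *)
Section TensorProduct.
Variables (k : fieldType) (G : groupType) (A : lmodType k).
Variables (B : representation k G) (X : Type).
Variables (ra : A -> X -> A) (lb : X -> B -> B).
Hypothesis lb_act : forall x g b, lb x (rep_act B g b) = rep_act B g (lb x b).

Local Notation free := (free_module k (A * B)).
Local Notation "a # b" := (delta k (a, b)) (at level 40).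

Inductive tensor_relation : free -> Prop :=
| TensorDl a a' b : tensor_relation ((a + a') # b - a # b - a' # b)
| TensorDr a b b' : tensor_relation (a # (b + b') - a # b - a # b')
| TensorZl c a b : tensor_relation ((c *: a) # b - c *: (a # b))
| TensorZr c a b : tensor_relation (a # (c *: b) - c *: (a # b))
| TensorBalanced a x b : tensor_relation (ra a x # b - a # lb x b).

Fact push_subproof (g : G) (f : free) :
  (fun ab => val f (ab.1, rep_act B g^-1%g ab.2)) \in sub_mem (finsupp k (A * B)).
Proof.
apply/asboolP; have /asboolP ff := valP f.
apply: sub_finite_set (finite_image (fun ab => (ab.1, rep_act B g ab.2)) ff).
move=> [a b] /= fab; exists (a, rep_act B g^-1%g b) => //=.
by rewrite -rep_actM mulgV rep_act1.
Qed.
Definition push g f : free := Subspace (push_subproof g f).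
Fact push_linear g : linear (push g).
Proof. by move=> a u v; apply/val_inj/funext. Qed.
HB.instance Definition _ g :=
  GRing.isLinear.Build k free free *:%R (push g) (push_linear g).
Fact push1 f : push 1%g f = f.
Proof. by apply/val_inj/funext => -[a b]; rewrite /= invg1 rep_act1. Qed.
Fact pushM g h f : push (g * h)%g f = push g (push h f).
Proof. by apply/val_inj/funext => -[a b]; rewrite /= invgM rep_actM. Qed.

Lemma push_delta g a b : push g (a # b) = a # rep_act B g b.
Proof.
apply/val_inj/funext => -[a' b'] /=; congr (nat_of_bool _)%:R.
apply: asbool_equiv_eq; split=> -[->].
  by move=> <-; rewrite -rep_actM mulgV rep_act1.
by move=> ->; rewrite -rep_actM mulVg rep_act1.
Qed.

Definition rep_free : representation k G :=
  @Representation k G free (fun g => push g) push1 pushM.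

Fact tensor_stable g (v : rep_free) : v \in sub_mem (span tensor_relation) ->
  rep_act rep_free g v \in sub_mem (span tensor_relation).
Proof.
apply: (@span_stable k free tensor_relation (push g)) => s rs.
apply/asboolP => W; apply.
have pd a b : (push g : {linear free -> free}) (a # b) = a # rep_act B g b.
  exact: push_delta.
case: rs => [a a' b|a b b'|c a b|c a b|a x b].
- by rewrite 2!linearB 3!pd; exact: TensorDl.
- by rewrite 2!linearB 3!pd (linearD (rep_act B g)); exact: TensorDr.
- by rewrite linearB linearZ_LR 2!pd; exact: TensorZl.
- by rewrite linearB linearZ_LR 2!pd (linearZ_LR (rep_act B g)); exact: TensorZr.
- by rewrite linearB 2!pd -lb_act; exact: TensorBalanced.
Qed.

(* A (x)_X B, with G acting through B *)
Definition tensor : representation k G := rep_quotient tensor_stable.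
End TensorProduct.

Section Center.
Variable G : groupType.

Definition center : {pred G} := [pred z | `[< forall g, (z * g = g * z)%g >]].

Definition mul_center (H : {pred G}) : {pred G} :=
  [pred g | `[< exists h z, [/\ h \in H, z \in center & g = (h * z)%g] >]].

Lemma centerC z g : z \in center -> (z * g = g * z)%g.
Proof. by move=> /asboolP. Qed.

Lemma center1 : 1%g \in center.
Proof. by apply/asboolP => g; rewrite mul1g mulg1. Qed.
Lemma centerM z t : z \in center -> t \in center -> (z * t)%g \in center.
Proof.
move=> Zz Zt; apply/asboolP => g.
by rewrite -mulgA (centerC g Zt) mulgA (centerC g Zz) mulgA.
Qed.
Lemma centerV z : z \in center -> z^-1%g \in center.
Proof.
move=> Zz; apply/asboolP => g.
by rewrite -[in RHS](mulKg z g) (centerC g Zz) -!mulgA mulgV mulg1.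
Qed.

Variable H : groupClosed G.

Fact mul_center1 : 1%g \in mul_center H.
Proof.
by apply/asboolP; exists 1%g, 1%g; rewrite gpred1 center1 mulg1.
Qed.
Fact mul_centerM : mulg_closed (mul_center H).
Proof.
move=> _ _ /asboolP[h [z [Hh Zz ->]]] /asboolP[h' [z' [Hh' Zz' ->]]].
apply/asboolP; exists (h * h')%g, (z * z')%g; rewrite gpredM ?centerM //.
by split=> //; rewrite -!mulgA (mulgA z) (centerC h' Zz) -mulgA.
Qed.
Fact mul_centerV : invg_closed (mul_center H).
Proof.
move=> _ /asboolP[h [z [Hh Zz ->]]].
apply/asboolP; exists h^-1%g, z^-1%g; rewrite gpredV centerV //.
by rewrite invgM (centerC _ (centerV Zz)).
Qed.
HB.instance Definition _ := isMulClosed.Build G (mul_center H) mul_centerM.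
HB.instance Definition _ := isMul1Closed.Build G (mul_center H) mul_center1.
HB.instance Definition _ := isInvClosed.Build G (mul_center H) mul_centerV.

Lemma sub_mul_center : {subset H <= mul_center H}.
Proof. by move=> h Hh; apply/asboolP; exists h, 1%g; rewrite center1 mulg1. Qed.

Lemma center_sub z : z \in center -> z \in mul_center H.
Proof. by move=> Zz; apply/asboolP; exists 1%g, z; rewrite gpred1 mul1g. Qed.
End Center.

Lemma cind_center (k : fieldType) (G : groupType) (H : groupClosed G) z
    (f : @cind k G (mul_center H)) :
  z \in @center G -> rep_act (@cind k G (mul_center H)) z f = f.
Proof.
move=> Zz; apply/val_inj/funext => x /=; rewrite (centerC x (centerV Zz)).
have [Hf _] := cindP f.
by rewrite Hf //; apply/center_sub/centerV.
Qed.

Record GL2 (F : fieldType) := GLtwo {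
  gl_mx :> 'M[F]_2;
  _ : gl_mx \in unitmx
}.

Section GL2Group.
Variable F : fieldType.

HB.instance Definition _ := [isSub of GL2 F for @gl_mx F].
HB.instance Definition _ := [Choice of GL2 F by <:].

Lemma gl_unit (g : GL2 F) : gl_mx g \in unitmx.
Proof. exact: valP. Qed.

Fact gl_mul_subproof (g h : GL2 F) : gl_mx g *m gl_mx h \in unitmx.
Proof. by rewrite unitmx_mul !gl_unit. Qed.
Fact gl_inv_subproof (g : GL2 F) : invmx g \in unitmx.
Proof. by rewrite unitmx_inv gl_unit. Qed.

Definition gl_one : GL2 F := GLtwo (unitmx1 F 2).
Definition gl_mul g h : GL2 F := GLtwo (gl_mul_subproof g h).
Definition gl_inv g : GL2 F := GLtwo (gl_inv_subproof g).

Fact gl_mulA : associative gl_mul.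
Proof. by move=> x y z; apply/val_inj; rewrite /= mulmxA. Qed.
Fact gl_mul1 : left_id gl_one gl_mul.
Proof. by move=> x; apply/val_inj; rewrite /= mul1mx. Qed.
Fact gl_1mul : right_id gl_one gl_mul.
Proof. by move=> x; apply/val_inj; rewrite /= mulmx1. Qed.
Fact gl_mulV : left_inverse gl_one gl_inv gl_mul.
Proof. by move=> x; apply/val_inj; rewrite /= mulVmx ?gl_unit. Qed.
Fact gl_Vmul : right_inverse gl_one gl_inv gl_mul.
Proof. by move=> x; apply/val_inj; rewrite /= mulmxV ?gl_unit. Qed.

HB.instance Definition _ :=
  isGroup.Build (GL2 F) gl_mulA gl_mul1 gl_1mul gl_mulV gl_Vmul.

Definition mx2 (a b c d : F) : 'M[F]_2 :=
  \matrix_(i, j) (if i == 0 then if j == 0 then a else b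
                  else if j == 0 then c else d).

(* The matrix (a b; c d) as an element of GL_2(F); the value is 1 if this
   matrix is singular. *)
Definition gl2 (a b c d : F) : GL2 F := insubd gl_one (mx2 a b c d).

Lemma gl2E a b c d : a * d - b * c != 0 -> gl_mx (gl2 a b c d) = mx2 a b c d.
Proof.
move=> nz; rewrite [LHS]insubdK //.
rewrite -topredE /= unitmxE (expand_det_row _ ord0) !big_ord_recl big_ord0.
rewrite /cofactor !det_mx11 !mxE /= expr0 expr1 mul1r mulN1r mulrN addr0.
by rewrite unitfE.
Qed.
End GL2Group.

Section Integers.
Variables (p : nat) (p_pr : prime p) (F : fieldExtType (padic p_pr)).

Definition padic_embed : padic_int p_pr -> F :=
  in_alg F \o @tofrac (padic_int p_pr).
HB.instance Definition _ := GRing.RMorphism.on padic_embed.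

(* The ring of integers of F is the integral closure of Z_p in F. *)
Definition integral_pred : {pred F} := [pred x | `[< integralOver padic_embed x >]].

Fact integral_pred_closed : subring_closed integral_pred.
Proof.
split=> [|x y /asboolP Ox /asboolP Oy|x y /asboolP Ox /asboolP Oy];
  apply/asboolP; [exact: integral1|exact: integral_sub|exact: integral_mul].
Qed.
HB.instance Definition _ :=
  GRing.isSubringClosed.Build F integral_pred integral_pred_closed.

Record integers := Integers { int_val :> F; _ : int_val \in integral_pred }.
HB.instance Definition _ := [isSub of integers for int_val].
HB.instance Definition _ := [Choice of integers by <:].
HB.instance Definition _ := [SubChoice_isSubComNzRing of integers by <:].

Definition integer_unit (x : integers) := exists y, x * y = 1.

(* w generates the ideal of non-units, the maximal ideal of O. *)
Definition uniformizer (w : integers) :=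
  w <> 0 /\ forall x, ~ integer_unit x <-> exists y, x = w * y.

Definition ramification_index (w : integers) (e : nat) :=
  exists2 u, integer_unit u & p%:R = u * w ^+ e.

Definition residue_map (k : fieldType) (red : {rmorphism integers -> k}) :=
  (forall a, exists x, red x = a) /\ (forall x, red x = 0 <-> ~ integer_unit x).

Definition teichmuller (k : fieldType) (red : integers -> k) (t : k -> integers) :=
  {morph t : a b / a * b} /\ cancel t red.

(* K = GL_2(O): the matrix and its inverse have integral entries. *)
Definition maxcompact : {pred GL2 F} :=
  [pred g | (gl_mx g \is a mxOver integral_pred) &&
            (invmx (gl_mx g) \is a mxOver integral_pred)].

Fact maxcompact1 : 1%g \in maxcompact.
Proof. by rewrite !inE /= invmx1 mxOver_scalar ?rpred0 ?rpred1. Qed.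
Fact maxcompactM : mulg_closed maxcompact.
Proof.
move=> g h /andP[g1 g2] /andP[h1 h2]; apply/andP; split.
  exact: mxOverM.
have -> : invmx (gl_mx (g * h)%g) = invmx h *m invmx g.
  exact: (congr1 (@gl_mx F) (invgM g h)).
exact: mxOverM.
Qed.
Fact maxcompactV : invg_closed maxcompact.
Proof. by move=> g; rewrite !inE /= invmxK andbC. Qed.
HB.instance Definition _ := isMulClosed.Build (GL2 F) maxcompact maxcompactM.
HB.instance Definition _ := isMul1Closed.Build (GL2 F) maxcompact maxcompact1.
HB.instance Definition _ := isInvClosed.Build (GL2 F) maxcompact maxcompactV.

Section ProPIwahori.
Variable w : integers.

Definition multiple : {pred F} := [pred x : F |
  `[< exists y : integers, x = int_val w * int_val y >]].

Fact multiple_zmod : zmod_closed multiple.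
Proof.
split=> [|_ _ /asboolP[y ->] /asboolP[z ->]]; apply/asboolP.
  by exists 0; rewrite mulr0.
by exists (y - z); rewrite mulrBr.
Qed.
HB.instance Definition _ := GRing.isZmodClosed.Build F multiple multiple_zmod.

Lemma multipleMr x y : x \in integral_pred -> y \in multiple -> x * y \in multiple.
Proof.
move=> Ox /asboolP[y' ->]; apply/asboolP; exists (Integers Ox * y').
by rewrite /= mulrCA.
Qed.
Lemma multipleMl x y : x \in integral_pred -> y \in multiple -> y * x \in multiple.
Proof. by rewrite mulrC; apply: multipleMr. Qed.

(* I(1): the elements of K congruent to an upper unipotent matrix mod w *)
Definition pro_p_iwahori : {pred GL2 F} :=
  [pred g : GL2 F | [&& g \in maxcompact, g 0 0 - 1 \in multiple,
                        g 1 1 - 1 \in multiple & g 1 0 \in multiple]].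

Fact pro_p_iwahori1 : 1%g \in pro_p_iwahori.
Proof.
apply/and4P; split; first exact: maxcompact1.
all: by rewrite mxE /= ?subrr rpred0.
Qed.
Fact pro_p_iwahoriM : mulg_closed pro_p_iwahori.
Proof.
move=> g h /and4P[Kg ga gd gc] /and4P[Kh ha hd hc].
have /andP[/mxOverP Og _] := Kg; have /andP[/mxOverP Oh _] := Kh.
have E i j : (g * h)%g i j = g i 0 * h 0 j + g i 1 * h 1 j.
  rewrite [LHS]mxE big_ord_recl big_ord1.
  by congr (_ * _ + g i _ * h _ j); apply/val_inj.
apply/and4P; split; rewrite ?E; first exact: maxcompactM.
- rewrite (_ : _ - 1 = (g 0 0 - 1) * h 0 0 + (h 0 0 - 1) + g 0 1 * h 1 0).
    apply: rpredD; last exact: multipleMr.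
    by apply: rpredD; first exact: multipleMl.
  by rewrite mulrBl mul1r addrA subrK addrAC.
- rewrite (_ : _ - 1 = g 1 0 * h 0 1 + ((g 1 1 - 1) * h 1 1 + (h 1 1 - 1))).
    apply: rpredD; first exact: multipleMl.
    by apply: rpredD; first exact: multipleMl.
  by rewrite mulrBl mul1r !addrA subrK.
- by apply: rpredD; [exact: multipleMl | exact: multipleMr].
Qed.
Fact pro_p_iwahoriV : invg_closed pro_p_iwahori.
Proof.
move=> g /and4P[Kg ga gd gc].
have Kh := maxcompactV Kg; set h := (g^-1)%g in Kh *.
have /andP[/mxOverP Og _] := Kg; have /andP[/mxOverP Oh _] := Kh.
have E i j : (i == j)%:R = h i 0 * g 0 j + h i 1 * g 1 j.
  have := congr1 (fun x : GL2 F => x i j) (mulVg g).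
  rewrite /= [LHS]mxE mxE => <-; rewrite big_ord_recl big_ord1.
  by congr (_ * _ + h i _ * g _ j); apply/val_inj.
have hc : h 1 0 \in multiple.
  rewrite (_ : h 1 0 = - (h 1 1 * g 1 0) - h 1 0 * (g 0 0 - 1)).
    by apply: rpredB; [rewrite rpredN|]; exact: multipleMr.
  rewrite mulrBr mulr1 opprB addrCA -opprD [_ * _ + _]addrC -E.
  by rewrite subr0.
apply/and4P; split=> //.
- rewrite (_ : _ - 1 = - (h 0 0 * (g 0 0 - 1)) - h 0 1 * g 1 0).
    by apply: rpredB; [rewrite rpredN|]; exact: multipleMr.
  by rewrite mulrBr mulr1 opprB -addrA -opprD -E.
- rewrite (_ : _ - 1 = - (h 1 1 * (g 1 1 - 1)) - h 1 0 * g 0 1).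
    by apply: rpredB; [rewrite rpredN; exact: multipleMr | exact: multipleMl].
  by rewrite mulrBr mulr1 opprB -addrA -opprD [_ * _ + _]addrC -E.
Qed.
HB.instance Definition _ := isMulClosed.Build (GL2 F) pro_p_iwahori pro_p_iwahoriM.
HB.instance Definition _ := isMul1Closed.Build (GL2 F) pro_p_iwahori pro_p_iwahori1.
HB.instance Definition _ := isInvClosed.Build (GL2 F) pro_p_iwahori pro_p_iwahoriV.
End ProPIwahori.
End Integers.

Section Supersingular.
Variables (p : nat) (p_pr : prime p) (F : fieldExtType (padic p_pr)).
Variable k : fieldType.

Definition KZ : groupClosed (GL2 F) := mul_center (@maxcompact p p_pr F).

(* T [g, 1] is the sum of the [g (w [x]; 0 1), 1], for x in F_q, and of
   [g (1 0; 0 w), 1]; an equivariant T is determined by these values. *)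
Definition spherical_hecke (w : integers F) (Fq : finFieldType)
    (t : Fq -> integers F) (T : rep_hom (cind k KZ) (cind k KZ)) :=
  forall g : GL2 F, T (bracket k KZ g) =
    \sum_(x : Fq) bracket k KZ (g * gl2 (w : F) (t x : F) 0 1)%g
      + bracket k KZ (g * gl2 1 0 0 (w : F))%g.

Definition pi0 (T : rep_hom (cind k KZ) (cind k KZ)) : representation k (GL2 F) :=
  cokernel T.

Lemma pi0_center T z (v : pi0 T) : z \in @center (GL2 F) -> rep_act (pi0 T) z v = v.
Proof.
move=> Zz; rewrite -(quot_piK v).
by rewrite [LHS]quot_mapE cind_center.
Qed.

Variable w : integers F.

Definition I1 : groupClosed (GL2 F) := pro_p_iwahori w.
Definition I1Z : groupClosed (GL2 F) := mul_center (pro_p_iwahori w).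

Lemma sub_I1Z : {subset I1 <= I1Z}.
Proof. exact: sub_mul_center. Qed.

Lemma pi0_invariants T v : v \in sub_mem (invariants (pi0 T) I1) ->
  v \in sub_mem (invariants (pi0 T) I1Z).
Proof.
move=> /invariantsP Iv; apply/invariantsP => g /asboolP[h [z [Ih Zz ->]]].
by rewrite rep_actM (pi0_center v Zz) Iv.
Qed.

Definition pi0_I1 T : lmodType k := subspace (invariants (pi0 T) I1).

Definition pi0_I1_act T : pi0_I1 T -> hecke_algebra k I1Z -> pi0_I1 T :=
  hecke_act sub_I1Z (@pi0_invariants T).

Definition cind_act (h : hecke_algebra k I1Z) (f : cind k I1Z) : cind k I1Z := h f.

Fact cind_act_equivariant h g f :
  cind_act h (rep_act (cind k I1Z) g f) = rep_act (cind k I1Z) g (cind_act h f).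
Proof. exact: rep_homE. Qed.

(* pi_0^{I(1)} (x)_H ind_{I(1)Z}^G 1 *)
Definition pi0_I1_tensor T : representation k (GL2 F) :=
  tensor (@pi0_I1_act T) cind_act_equivariant.
End Supersingular.

(* Main.v *)
From HB Require Import structures.
From mathcomp Require Import all_boot all_algebra all_field ring.
From mathcomp Require Import boolp classical_sets functions cardinality fsbigop.
Require Import Defs.
Set Implicit Arguments.
Unset Strict Implicit.
Unset Printing Implicit Defensive.
Import GRing.Theory.
Local Open Scope ring_scope.

(** The counit of the adjunction between invariants and tensoring,
    Phi : v (x) f |-> \sum_(g) f(g) g v ([tensor_counit]), maps the tensor
    product to pi0, and M exists as soon as Phi has an equivariant section, namely
    as the cokernel of this section ([retract_iso]).

    Let v0 in pi0 be the class of [1, 1], which generates pi0, and put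
    x = v0 (x) [1, 1].  As Phi(x) = v0, the section can only be [g, 1] |-> g x.
    It is well defined when x is fixed by KZ and the relation that Im T imposes
    on v0 also holds for x.  Both follow from one principle
    ([pure_tensor_hecke]): an I(1)Z-invariant f in ind 1 is h [1, 1] for some
    Hecke operator h, so v0 (x) f = (v0 h) (x) [1, 1], where v0 h = Phi(v0 (x) f)
    is computed inside pi0.

    For x to be fixed by K, the group I(1) and the center are clear.  A diagonal
    matrix a with unit entries normalizes I(1), so f = [a, 1] is invariant and
    v0 h = a v0 = v0.  For the Weyl element s, write u_l for the unipotent
    matrix with upper right entry [l]; the sum over l in F_q of [u_l s, 1] is
    invariant, and v0 h = q v0 = 0.  So \sum_l u_l s x = 0.  Applying s and using
    that s u_l s lies in u_(1/l) s B for l != 0, where the upper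
    triangular matrices B of K fix x, gives x + \sum_(l != 0) u_l s x = 0, whence
    s x = x ([swap_fixes]).  Finally I(1), the diagonal matrices and s generate
    K ([maxcompact_fixes]).

    For the relation of T, let b = diag(1, w), and let n = b s, which normalizes
    I(1).  With f the sum of the [u_l diag(w, 1), 1], the relation in pi0 says
    that v0 h = - b v0 = - n v0, and the principle applied to [n, 1] gives n v0 (x) [1, 1] = n x = b x.  Hence
    \sum_l u_l diag(w, 1) x + b x = 0, as required ([generator_hecke]). *)

(** * Morphisms of representations *)

Section Maps.
Variables (k : fieldType) (G : groupType).
Implicit Types U V : representation k G.

(** This form lets a morphism be introduced in the middle of a proof without
    declaring a linear structure for its underlying function. *)
Lemma rep_hom_of U V (f : U -> V) :
    linear f -> (forall g u, f (rep_act U g u) = rep_act V g (f u)) ->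
  exists phi : rep_hom U V, phi =1 f.
Proof.
move=> fL fG.
pose F : {linear U -> V} := HB.pack f (GRing.isLinear.Build k U V *:%R f fL).
by exists (@RepHom k G U V F fG).
Qed.

Lemma rep_hom_comp U V W (psi : rep_hom V W) (phi : rep_hom U V) :
  exists chi : rep_hom U W, forall u, chi u = psi (phi u).
Proof.
by apply: rep_hom_of => [a u v|g u]; rewrite ?linearP // !rep_homE.
Qed.

Lemma quotient_lift U V (W : submodule U)
    (stW : forall g v, v \in sub_mem W -> rep_act U g v \in sub_mem W)
    (f : rep_hom U V) :
    (forall v, v \in sub_mem W -> f v = 0) ->
  exists phi : rep_hom (rep_quotient stW) V, forall v, phi (quot_pi W v) = f v.
Proof.
move=> fW.
have fE v : f (quot_repr (quot_pi W v)) = f v.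
  apply/eqP; rewrite -subr_eq0 -linearB fW //.
  by apply/quot_piP; rewrite quot_piK.
have [] := @rep_hom_of (rep_quotient stW) V (fun x => f (quot_repr x)).
- move=> a x y; rewrite -{1}(quot_piK x) -{1}(quot_piK y) -linearP fE.
  by rewrite linearP.
- move=> g x; rewrite -{1}(quot_piK x).
  by rewrite [X in quot_repr X](quot_mapE (stW g)) fE rep_homE.
- by move=> phi phiE; exists phi => v; rewrite phiE fE.
Qed.

(** The cokernel of i plays the part of the kernel of r, to which it is
    isomorphic. *)
Lemma retract_iso U V (i : rep_hom U V) (r : rep_hom V U) :
  cancel i r -> exists M, rep_iso V (rep_sum U M).
Proof.
move=> ri; exists (cokernel i).
have [] := @rep_hom_of V (rep_sum U (cokernel i))
  (fun v => (r v, quot_pi (image i) v)).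
- by move=> a x y; rewrite !linearP.
- move=> g v; rewrite /= /sum_act rep_homE; congr (_, _).
  by rewrite [RHS]quot_mapE.
move=> phi phiE; exists phi.
exists (fun y => i y.1 + (quot_repr y.2 - i (r (quot_repr y.2)))).
  move=> v; rewrite phiE /=.
  have /quot_piP/asboolP[u E] := quot_piK (quot_pi (image i) v).
  move/eqP: E; rewrite subr_eq => /eqP ->.
  by rewrite linearD ri linearD opprD addrACA subrr add0r addrCA subrr addr0.
case=> u y; rewrite phiE /=; congr (_, _).
  by rewrite linearD linearB /= !ri subrr addr0.
rewrite -[RHS]quot_piK; apply/quot_piP.
rewrite addrCA [_ + _ - _]addrAC addrN add0r.
by rewrite -linearB; apply/asboolP; eexists.
Qed.
End Maps.

(** * Maps out of free modules and tensor products *)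

Section FreeLift.
Variables (k : fieldType) (T : choiceType) (V : lmodType k) (phi : T -> V).
Local Notation free := (free_module k T).

Definition free_lift (f : free) : V :=
  \sum_(x \in [set: T]%classic) (val f x *: phi x).

Lemma free_lift_seq (f : free) (r : seq T) :
    uniq r -> (forall x, val f x != 0 -> x \in r) ->
  free_lift f = \sum_(x <- r) (val f x *: phi x).
Proof.
move=> ur fr; rewrite /free_lift -(fsbig_widen [set` r]) -?fsbig_seq //.
move=> x [_ /= xr]; have [->|/fr //] := eqVneq (val f x) 0.
by rewrite scale0r.
Qed.

Lemma free_lift_linear : linear free_lift.
Proof.
move=> a f g.
have /asboolP/finite_seqP[rf Ef] := valP f.
have /asboolP/finite_seqP[rg Eg] := valP g.
pose r := undup (rf ++ rg).
have fr x : val f x != 0 -> x \in r.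
  move=> fx; have : [set` rf]%classic x by rewrite -Ef.
  by rewrite mem_undup mem_cat /= => ->.
have gr x : val g x != 0 -> x \in r.
  move=> gx; have : [set` rg]%classic x by rewrite -Eg.
  by rewrite mem_undup mem_cat /= => ->; rewrite orbT.
have valE x : val (a *: f + g) x = a * val f x + val g x.
  by rewrite [val _]linearP.
rewrite !(@free_lift_seq _ r) ?undup_uniq //; last first.
  move=> x; rewrite valE; have [->|fx _] := eqVneq (val f x) 0; last exact: fr.
  by rewrite mulr0 add0r; apply: gr.
rewrite scaler_sumr -big_split; apply: eq_bigr => x _.
by rewrite valE scalerDl scalerA.
Qed.
HB.instance Definition _ :=
  GRing.isLinear.Build k free V *:%R free_lift free_lift_linear.

Lemma free_lift_delta t : free_lift (delta k t) = phi t.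
Proof.
rewrite (@free_lift_seq _ [:: t]) ?big_seq1 /=.
- by rewrite asboolT ?scale1r.
- by [].
- by move=> x /=; rewrite inE; case: asboolP => [->|]; rewrite ?eqxx.
Qed.
End FreeLift.

Section PureTensors.
Variables (k : fieldType) (G : groupType) (A : lmodType k).
Variables (B : representation k G) (X : Type).
Variables (ra : A -> X -> A) (lb : X -> B -> B).
Hypothesis lb_act : forall x g b, lb x (rep_act B g b) = rep_act B g (lb x b).

Local Notation tensor := (tensor ra lb_act).

Definition pure_tensor (a : A) (b : B) : tensor :=
  quot_pi (span (tensor_relation ra lb)) (delta k (a, b)).

Let relP u v : tensor_relation ra lb (u - v) ->
  quot_pi (span (tensor_relation ra lb)) u =
    quot_pi (span (tensor_relation ra lb)) v.
Proof. by move=> ruv; apply/quot_piP/asboolP => W; apply. Qed.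

Lemma pure_tensorDr a b b' :
  pure_tensor a (b + b') = pure_tensor a b + pure_tensor a b'.
Proof.
rewrite [RHS](esym (quot_piD _ _ _)); apply: relP.
by rewrite opprD addrA; apply: TensorDr.
Qed.

Lemma pure_tensorZl c a b : pure_tensor (c *: a) b = c *: pure_tensor a b.
Proof. rewrite [RHS](esym (quot_piZ _ _ _)); exact/relP/TensorZl. Qed.

Lemma pure_tensorZr c a b : pure_tensor a (c *: b) = c *: pure_tensor a b.
Proof. rewrite [RHS](esym (quot_piZ _ _ _)); exact/relP/TensorZr. Qed.

Lemma pure_tensor_balanced a x b :
  pure_tensor (ra a x) b = pure_tensor a (lb x b).
Proof. exact/relP/TensorBalanced. Qed.

Lemma pure_tensor_act g a b :
  rep_act tensor g (pure_tensor a b) = pure_tensor a (rep_act B g b).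
Proof. by rewrite [LHS]quot_mapE [rep_act _ _ _](push_delta g a b). Qed.

Lemma pure_tensor_sum I r (P : pred I) (F : I -> B) a :
  pure_tensor a (\sum_(i <- r | P i) F i) =
    \sum_(i <- r | P i) pure_tensor a (F i).
Proof.
apply: (big_morph _ (pure_tensorDr a)).
by rewrite -(scale0r 0) pure_tensorZr scale0r.
Qed.

(** The universal property of the tensor product, for maps that commute with
    the action of G on the second factor. *)
Lemma tensor_lift (V : representation k G) (psi : A -> B -> V) :
    (forall b, linear (psi^~ b)) -> (forall a, linear (psi a)) ->
    (forall a x b, psi (ra a x) b = psi a (lb x b)) ->
    (forall a g b, psi a (rep_act B g b) = rep_act V g (psi a b)) ->
  exists Phi : rep_hom tensor V, forall a b, Phi (pure_tensor a b) = psi a b.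
Proof.
move=> psil psir psib psig.
pose L := free_lift (fun ab : A * B => psi ab.1 ab.2).
have LE a b : L (delta k (a, b)) = psi a b by apply: free_lift_delta.
have [||L' L'E] := @rep_hom_of k G (rep_free A B) V L.
- exact: free_lift_linear.
- move=> g f.
  have /asboolP/finite_seqP[r Er] := valP f.
  have fr x : val f x != 0 -> x \in undup r.
    move=> fx; have : [set` r]%classic x by rewrite -Er.
    by rewrite /= mem_undup.
  pose gx x : A * B := (x.1, rep_act B g x.2).
  have gK : cancel gx (fun x => (x.1, rep_act B g^-1%g x.2)).
    by case=> a b; rewrite /gx /= -rep_actM mulVg rep_act1.
  rewrite [RHS](congr1 _ (free_lift_seq _ (undup_uniq r) fr)).
  rewrite [LHS](@free_lift_seq _ _ _ _ _ (map gx (undup r))); first last.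
  - move=> x /= /fr xr; apply/mapP; exists (x.1, rep_act B g^-1%g x.2) => //.
    by case: x {xr} => a b; rewrite /gx /= -rep_actM mulgV rep_act1.
  - by rewrite map_inj_uniq ?undup_uniq //; apply: can_inj gK.
  rewrite linear_sum big_map; apply: eq_bigr => -[a b] _.
  rewrite linearZ_LR -psig /=; congr (val f _ *: _).
  exact: gK (a, b).
have [|Phi PhiE] := quotient_lift (tensor_stable lb_act (ra := ra)) (f := L').
  move=> f /asboolP Sf.
  have clK : submod_closed [pred u | L' u == 0].
    split; first by rewrite inE linear0.
    by move=> c u v /eqP u0 /eqP v0; rewrite inE linearP u0 v0 scaler0 addr0.
  apply/eqP; apply: (Sf (Submodule clK)) => _ [a a' b|a b b'|c a b|c a b|a x b];
    rewrite inE !(linearB, linearZ_LR) /= !L'E !LE.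
  - by rewrite -[a]scale1r psil !scale1r addrAC addrK subrr.
  - by rewrite -[b]scale1r psir !scale1r addrAC addrK subrr.
  - by rewrite (GRing.scalable_linear (psil b)) scalerN subrr.
  - by rewrite (GRing.scalable_linear (psir a)) scalerN subrr.
  - by rewrite psib subrr.
by exists Phi => a b; rewrite PhiE L'E LE.
Qed.
End PureTensors.

(** * Hecke operators and the tensor product *)

Section CindMaps.
Variables (k : fieldType) (G : groupType) (H : groupClosed G).
Variable V : representation k G.

Lemma bracketMr g h : h \in H -> bracket k H (g * h)%g = bracket k H g.
Proof.
move=> Hh; apply/val_inj/funext => x /=.
by rewrite invgM -mulgA gpredMl ?gpredV.
Qed.

Lemma cind_hom_eq (phi psi : rep_hom (cind k H) V) :
  phi (bracket k H 1%g) = psi (bracket k H 1%g) -> phi =1 psi.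
Proof. by move=> E f; rewrite -frob_unique E frob_unique. Qed.

Lemma frob_linearl (f : cind k H) : linear (fun v : V => frob v f).
Proof.
move=> a u v; have [r rf _] := supporting_exists f f.
rewrite !(frob_seq _ rf) scaler_sumr -big_split /=; apply: eq_bigr => x _.
by rewrite linearP scalerDr !scalerA mulrC.
Qed.

Lemma frob0l (f : cind k H) : frob (0 : V) f = 0.
Proof.
by have := frob_linearl f (-1) 0 0; rewrite scaler0 add0r scaleN1r addNr.
Qed.
End CindMaps.

Section HeckeTensor.
Variables (k : fieldType) (G : groupType) (J H : groupClosed G).
Variable V : representation k G.
Hypothesis JH : {subset J <= H}.
Hypothesis VJ : forall v, v \in invariants V J -> v \in invariants V H.
Hypothesis lb_act : forall (h : hecke_algebra k H) g f,
  h (rep_act (cind k H) g f) = rep_act (cind k H) g (h f).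

Local Notation pure_tensor :=
  (@pure_tensor k G _ (cind k H) _ (hecke_act JH VJ)
     (fun (h : hecke_algebra k H) f => h f) lb_act).

Lemma tensor_counit :
  exists Phi : rep_hom (tensor (hecke_act JH VJ) lb_act) V,
    forall v f, Phi (pure_tensor v f) = frob (val v) f.
Proof.
apply: tensor_lift => [f a u v|v a u1 u2|v h f|v g f].
- exact: frob_linearl.
- exact: linearP.
- have Hv := VJ (valP v).
  have [||phi phiE] :=
    @rep_hom_of k G (cind k H) V (fun f => frob (val v) (h f)).
  + by move=> a u1 u2; rewrite !linearP.
  + by move=> g u; rewrite rep_homE frob_act.
  by rewrite -phiE -frob_unique phiE.
- exact/frob_act/VJ/valP.
Qed.

(** By Frobenius reciprocity every invariant u is h [1, 1] for a Hecke
    operator h; moving h across the tensor sign turns a statement about the tensor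
    product into the computation of a sum in V. *)
Lemma pure_tensor_hecke (u : cind k H) (v v' : subspace (invariants V J)) :
    u \in invariants (cind k H) H -> val v' = frob (val v) u ->
  pure_tensor v u = pure_tensor v' (bracket k H 1%g).
Proof.
move=> Hu v'E.
have [||h hE] := @rep_hom_of k G (cind k H) (cind k H) (frob u).
- by move=> a x y; rewrite linearP.
- by move=> g x; rewrite frob_act.
have h1 : h (bracket k H 1%g) = u by rewrite hE frob_bracket // rep_act1.
have -> : v' = hecke_act JH VJ v h by apply: val_inj; rewrite /= h1.
by rewrite pure_tensor_balanced h1.
Qed.

End HeckeTensor.

(** * Two by two matrices *)

Section Matrices.
Variable F : fieldType.
Implicit Types (g h : GL2 F) (a b c d : F).

Lemma gl2_entries a b c d : a * d - b * c != 0 ->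
  [/\ gl2 a b c d 0 0 = a, gl2 a b c d 0 1 = b,
      gl2 a b c d 1 0 = c & gl2 a b c d 1 1 = d].
Proof. by move=> /gl2E ->; split; rewrite mxE. Qed.

Lemma det_mx2 (A : 'M[F]_2) : \det A = A 0 0 * A 1 1 - A 0 1 * A 1 0.
Proof.
rewrite (expand_det_row _ 0) !big_ord_recl big_ord0 /cofactor !det_mx11 !mxE /=.
rewrite expr0 expr1 mul1r mulN1r mulrN addr0.
by congr (A _ _ * A _ _ - A _ _ * A _ _); apply/val_inj.
Qed.

Lemma gl_det_neq0 g : g 0 0 * g 1 1 - g 0 1 * g 1 0 != 0.
Proof. by rewrite -det_mx2 -unitfE -unitmxE gl_unit. Qed.

Lemma gl_mulE g h i j : (g * h)%g i j = g i 0 * h 0 j + g i 1 * h 1 j.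
Proof.
rewrite [LHS]mxE big_ord_recl big_ord1.
by congr (_ * _ + g i _ * h _ j); apply/val_inj.
Qed.

Lemma gl_eq g h : g 0 0 = h 0 0 -> g 0 1 = h 0 1 -> g 1 0 = h 1 0 ->
  g 1 1 = h 1 1 -> g = h.
Proof.
move=> e00 e01 e10 e11; apply/val_inj/matrixP => i j.
have ordE (l : 'I_2) : l = 0 \/ l = 1.
  by case: l => [[|[|//]] ?]; [left|right]; apply/val_inj.
by case: (ordE i) => ->; case: (ordE j) => ->.
Qed.

Lemma gl2_id g : gl2 (g 0 0) (g 0 1) (g 1 0) (g 1 1) = g.
Proof. by have [? ? ? ?] := gl2_entries (gl_det_neq0 g); apply: gl_eq. Qed.

Lemma gl2M a b c d a' b' c' d' :
    a * d - b * c != 0 -> a' * d' - b' * c' != 0 ->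
  (gl2 a b c d * gl2 a' b' c' d')%g =
    gl2 (a * a' + b * c') (a * b' + b * d') (c * a' + d * c') (c * b' + d * d').
Proof.
move=> D D'.
have DD : (a * a' + b * c') * (c * b' + d * d') -
    (a * b' + b * d') * (c * a' + d * c') != 0.
  rewrite (_ : _ - _ = (a * d - b * c) * (a' * d' - b' * c')) ?mulf_neq0 //.
  by ring.
have [e1 e2 e3 e4] := gl2_entries D.
have [e1' e2' e3' e4'] := gl2_entries D'.
have [f1 f2 f3 f4] := gl2_entries DD.
by apply: gl_eq; rewrite gl_mulE 
  ?(e1, e2, e3, e4, e1', e2', e3', e4', f1, f2, f3, f4).
Qed.

Lemma gl2_1 : gl2 1 0 0 1 = 1%g :> GL2 F.
Proof.
have D : 1 * 1 - 0 * 0 != 0 :> F by rewrite mulr1 mulr0 subr0 oner_eq0.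
by have [a b c d] := gl2_entries D; apply: gl_eq; rewrite ?(a, b, c, d) mxE.
Qed.
End Matrices.

(** * Units and multiples of the uniformizer *)

Section Local.
Variables (p : nat) (p_pr : prime p) (F : fieldExtType (padic p_pr)).
Variables (w : integers F) (hw : uniformizer w).
Local Notation O := (@integral_pred p p_pr F).
Local Notation mult := (multiple w).
Local Notation K := (@maxcompact p p_pr F).
Local Notation I1 := (pro_p_iwahori w).

Lemma uniformizer_neq0 : (w : F) != 0.
Proof. by case: hw => w0 _; apply/eqP => wE; apply: w0; apply: val_inj. Qed.

Lemma multiple_int x : x \in mult -> x \in O.
Proof. by move=> /asboolP[y ->]; rewrite rpredM ?(valP w) ?(valP y). Qed.

Lemma multiple_w x : x \in O -> (w : F) * x \in mult.
Proof. by move=> Ox; apply/asboolP; exists (Integers Ox). Qed.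

Lemma multiple_divw x : x \in mult -> x / (w : F) \in O.
Proof.
by move=> /asboolP[y ->]; rewrite mulrAC mulfV ?uniformizer_neq0 // mul1r (valP y).
Qed.

Lemma integer_unitP (x : integers F) :
  integer_unit x <-> (x : F) != 0 /\ (x : F)^-1 \in O.
Proof.
split=> [[y /(congr1 val) /= xy]|[x0 Ox]].
  have x0 : (x : F) != 0.
    by apply/eqP => x0; move: xy; rewrite x0 mul0r => /esym/eqP; rewrite oner_eq0.
  by split; rewrite // -[_^-1]mulr1 -xy mulKf // (valP y).
by exists (Integers Ox); apply/val_inj; rewrite /= mulfV.
Qed.

Lemma unit_or_multiple x : x \in O -> (x != 0 /\ x^-1 \in O) \/ x \in mult.
Proof.
move=> Ox; have [[y xy]|nu] := pselect (integer_unit (Integers Ox)).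
  by left; apply/(integer_unitP (Integers Ox)); exists y.
by right; have [y /(congr1 val) /= ->] := (hw.2 _).1 nu; apply/multiple_w/(valP y).
Qed.

Lemma multiple_not_unit x : x \in mult -> x != 0 -> x^-1 \notin O.
Proof.
move=> /asboolP[y xE] x0; apply/negP => Ox.
have : ~ integer_unit w by apply/(hw.2 w); exists 1; rewrite mulr1.
case; exists (y * Integers Ox); apply/val_inj.
by rewrite /= mulrA -xE mulfV.
Qed.

Lemma unit_of_1 x : x - 1 \in mult -> x != 0 /\ x^-1 \in O.
Proof.
move=> mx; have Ox : x \in O by rewrite -(subrK 1 x) rpredD ?rpred1 ?multiple_int.
have [//|mx'] := unit_or_multiple Ox.
have /multiple_not_unit := rpredB mx' mx.
by rewrite opprB addrC subrK oner_eq0 invr1 rpred1 => /(_ isT).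
Qed.

Lemma maxcompact_mem (g : GL2 F) :
    [/\ g 0 0 \in O, g 0 1 \in O, g 1 0 \in O & g 1 1 \in O] ->
  (\det (gl_mx g))^-1 \in O -> g \in K.
Proof.
move=> [a b c d] D.
have ordE (l : 'I_2) : l = 0 \/ l = 1.
  by case: l => [[|[|//]] ?]; [left|right]; apply/val_inj.
have Og : gl_mx g \is a mxOver O.
  by apply/mxOverP => i j; case: (ordE i) => ->; case: (ordE j) => ->.
apply/andP; split=> //; apply/mxOverP => i j.
rewrite /invmx gl_unit mxE rpredM // mxE /cofactor rpredM ?rpredX ?rpredN ?rpred1 //.
by rewrite det_mx11 !mxE (mxOverP Og).
Qed.

Lemma maxcompact_entries (g : GL2 F) : g \in K ->
  [/\ g 0 0 \in O, g 0 1 \in O, g 1 0 \in O, g 1 1 \in O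
    & (\det (gl_mx g))^-1 \in O].
Proof.
move=> /andP[/mxOverP Og /mxOverP Oh]; split=> //.
by rewrite -det_inv det_mx2 rpredB ?rpredM.
Qed.

Lemma iwahori_mem (g : GL2 F) :
    g 0 0 - 1 \in mult -> g 0 1 \in O -> g 1 0 \in mult ->
  g 1 1 - 1 \in mult -> g \in I1.
Proof.
move=> a b c d; apply/and4P; split=> //.
have O1 x : x - 1 \in mult -> x \in O.
  by move=> mx; rewrite -(subrK 1 x) rpredD ?rpred1 ?multiple_int.
apply: maxcompact_mem.
  by split=> //; [apply: O1|apply: multiple_int|apply: O1].
have [] // := @unit_of_1 (\det (gl_mx g)).
rewrite det_mx2 (_ : _ - 1 = (g 0 0 - 1) * g 1 1 + (g 1 1 - 1) - g 0 1 * g 1 0).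
  apply: rpredB; last exact: multipleMr.
  by apply: rpredD => //; apply: multipleMl => //; apply: O1.
by ring.
Qed.

Lemma iwahori_entries (g : GL2 F) : g \in I1 ->
  [/\ g 0 0 - 1 \in mult, g 0 1 \in O, g 1 0 \in mult & g 1 1 - 1 \in mult].
Proof. by move=> /and4P[/maxcompact_entries[]]. Qed.

End Local.

(** * Generators of K and elements that normalize I(1) *)

Section Elements.
Variables (p : nat) (p_pr : prime p) (F : fieldExtType (padic p_pr)).
Variables (w : integers F) (hw : uniformizer w).
Local Notation O := (@integral_pred p p_pr F).
Local Notation mult := (multiple w).
Local Notation K := (@maxcompact p p_pr F).
Local Notation I1 := (pro_p_iwahori w).

Definition unip (x : F) : GL2 F := gl2 1 x 0 1.
Definition diag (a d : F) : GL2 F := gl2 a 0 0 d.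
Definition swap : GL2 F := gl2 0 1 1 0.

Lemma unip_det x : 1 * 1 - x * 0 != 0 :> F.
Proof. by rewrite mulr1 mulr0 subr0 oner_eq0. Qed.
Lemma diag_det a d : a != 0 -> d != 0 -> a * d - 0 * 0 != 0 :> F.
Proof. by move=> a0 d0; rewrite mulr0 subr0 mulf_neq0. Qed.
Lemma swap_det : 0 * 0 - 1 * 1 != 0 :> F.
Proof. by rewrite mulr1 mulr0 sub0r oppr_eq0 oner_eq0. Qed.
Hint Resolve unip_det diag_det swap_det : core.

Lemma swapK : (swap * swap)%g = 1%g.
Proof.
by rewrite gl2M // -gl2_1; congr gl2; ring.
Qed.

Lemma diagV a d : a != 0 -> d != 0 -> (diag a d)^-1%g = diag a^-1 d^-1.
Proof.
move=> a0 d0; apply: mulg1_eq; rewrite gl2M ?diag_det ?invr_eq0 // -gl2_1.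
by congr gl2; field; rewrite ?a0.
Qed.

Lemma unip_iwahori x : x \in O -> unip x \in I1.
Proof.
move=> Ox; have [a b c d] := gl2_entries (unip_det x).
by apply: (iwahori_mem hw); rewrite ?(a, b, c, d) ?subrr ?rpred0.
Qed.

Lemma swap_maxcompact : swap \in K.
Proof.
have [a b c d] := gl2_entries swap_det.
apply: maxcompact_mem; first by rewrite a b c d rpred0 rpred1.
by rewrite det_mx2 a b c d mulr0 mulr1 sub0r invrN invr1 rpredN rpred1.
Qed.

Lemma conj_swap (h : GL2 F) : h \in I1 -> h 0 1 \in mult ->
  (swap^-1 * h * swap)%g \in I1.
Proof.
move=> /iwahori_entries[a b c d] b'.
have -> : swap^-1%g = swap by apply/mulg1_eq/swapK.
have [e1 e2 e3 e4] := gl2_entries swap_det.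
apply: (iwahori_mem hw); rewrite !gl_mulE !(e1, e2, e3, e4);
  rewrite !(mul0r, mulr0, mul1r, mulr1, add0r, addr0) //.
exact: multiple_int c.
Qed.

Lemma conj_diag (a d : F) (h : GL2 F) : a != 0 -> d != 0 -> h \in I1 ->
    a^-1 * h 0 1 * d \in O -> d^-1 * h 1 0 * a \in mult ->
  ((diag a d)^-1 * h * diag a d)%g \in I1.
Proof.
move=> a0 d0 /iwahori_entries[h00 _ _ h11] h01 h10.
rewrite diagV //.
have [e1 e2 e3 e4] := gl2_entries (diag_det a0 d0).
have [|f1 f2 f3 f4] := @gl2_entries F a^-1 0 0 d^-1.
  by rewrite diag_det ?invr_eq0.
apply: (iwahori_mem hw); rewrite !gl_mulE !(e1, e2, e3, e4, f1, f2, f3, f4);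
 rewrite !(mul0r, mulr0, mul1r, mulr1, add0r, addr0) //.
  by rewrite mulrAC mulVf ?mul1r.
by rewrite mulrAC mulVf ?mul1r.
Qed.

Lemma conj_diag_unit (a d : F) (h : GL2 F) :
    a != 0 -> d != 0 -> a \in O -> d \in O -> a^-1 \in O -> d^-1 \in O ->
  h \in I1 -> ((diag a d)^-1 * h * diag a d)%g \in I1.
Proof.
move=> a0 d0 Oa Od Oa' Od' Ih; have [_ h01 h10 _] := iwahori_entries Ih.
apply: conj_diag => //; first by rewrite !rpredM.
by apply: multipleMl => //; apply: multipleMr.
Qed.

Lemma conj_w (h : GL2 F) : h \in I1 -> h 0 1 \in mult ->
  ((diag (w : F) 1%R)^-1 * h * diag (w : F) 1%R)%g \in I1.
Proof.
move=> Ih h01; have [_ _ h10 _] := iwahori_entries Ih.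
apply: conj_diag; rewrite ?oner_eq0 ?(uniformizer_neq0 hw) //.
  by rewrite mulr1 mulrC (multiple_divw hw).
by rewrite invr1 mul1r mulrC multiple_w // (multiple_int h10).
Qed.

(** This is (0 1; w 0), the element of the normalizer of I(1) that exchanges the
    two ends of the edge of the tree fixed by I(1). *)
Definition atkin : GL2 F := (diag 1%R (w : F) * swap)%g.

Lemma conj_atkin h : h \in I1 -> (atkin^-1 * h * atkin)%g \in I1.
Proof.
move=> Ih; have [h00 h01 h10 h11] := iwahori_entries Ih.
have w0 := uniformizer_neq0 hw.
have D : 1 * (w : F) - 0 * 0 != 0 by rewrite diag_det ?oner_eq0.
have D' : 0 * 0 - (w : F)^-1 * 1 != 0.
  by rewrite mulr1 mulr0 sub0r oppr_eq0 invr_eq0.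
have aE : atkin = gl2 0 1 (w : F) 0.
  by rewrite /atkin gl2M //; congr gl2; ring.
have Da : 0 * 0 - 1 * (w : F) != 0 by rewrite mul1r mulr0 sub0r oppr_eq0.
have aV : atkin^-1%g = gl2 0 (w : F)^-1 1 0.
  apply: mulg1_eq; rewrite aE gl2M // -gl2_1.
  by congr gl2; field.
have [e1 e2 e3 e4] := gl2_entries Da.
have [f1 f2 f3 f4] := gl2_entries D'.
rewrite aV aE.
apply: (iwahori_mem hw); rewrite !gl_mulE !(e1, e2, e3, e4, f1, f2, f3, f4);
 rewrite !(mul0r, mulr0, mul1r, mulr1, add0r, addr0) //.
- by rewrite mulrAC mulVf ?mul1r.
- by rewrite mulrC (multiple_divw hw).
- by rewrite mulrC multiple_w.
Qed.

(** The Bruhat decomposition of GL_2 over the residue field: modulo I(1) and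
    the diagonal, an element with lower left entry c in the maximal ideal is
    trivial, and one with c a unit is u s b with u unipotent and b upper
    triangular. *)
Lemma maxcompact_fixes k (V : representation k (GL2 F)) (x : V) :
    (forall h, h \in I1 -> rep_act V h x = x) ->
    (forall a d, a != 0 -> d != 0 -> a \in O -> d \in O ->
       a^-1 \in O -> d^-1 \in O ->
       rep_act V (diag a d) x = x) ->
    rep_act V swap x = x ->
  forall g, g \in K -> rep_act V g x = x.
Proof.
move=> Ix Dx Sx.
have triv g : g \in K -> g 1 0 \in mult -> rep_act V g x = x.
  move=> Kg gc; have [Oa Ob Oc Od OD] := maxcompact_entries Kg.
  have D0 := gl_det_neq0 g; rewrite det_mx2 in OD.
  have nm : g 0 0 * g 1 1 - g 0 1 * g 1 0 \notin mult.
    by apply: contraL OD => /(multiple_not_unit hw)/(_ D0).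
  have [[a0 Oa']|ma] := unit_or_multiple hw Oa; last first.
    by case/negP: nm; apply: rpredB; [apply: multipleMl|apply: multipleMr].
  have [[d0 Od']|md] := unit_or_multiple hw Od; last first.
    by case/negP: nm; apply: rpredB; apply: multipleMr.
  have E : 1 * 1 - (g 0 1 / g 1 1) * (g 1 0 / g 0 0) != 0.
    rewrite (_ : _ - _ = (g 0 0 * g 1 1 - g 0 1 * g 1 0) / (g 0 0 * g 1 1)).
      by rewrite mulf_neq0 ?invr_eq0 ?mulf_neq0.
    by field; rewrite a0 d0.
  pose n := gl2 1 (g 0 1 / g 1 1) (g 1 0 / g 0 0) 1.
  pose m := diag (g 0 0) (g 1 1).
  have -> : g = (n * m)%g.
    by rewrite gl2M ?diag_det // -{1}(gl2_id g); congr gl2; field.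
  rewrite rep_actM Dx // Ix //.
  have [e1 e2 e3 e4] := gl2_entries E.
  apply: (iwahori_mem hw); rewrite ?e1 ?e2 ?e3 ?e4 ?subrr ?rpred0 ?rpredM //.
  exact: multipleMl.
move=> g Kg; have [Oa Ob Oc Od OD] := maxcompact_entries Kg.
have [[c0 Oc']|] := unit_or_multiple hw Oc; last exact: triv.
pose u := unip (g 0 0 / g 1 0).
have Iu : u \in I1 by apply/unip_iwahori/rpredM.
pose b : GL2 F := (swap * u^-1 * g)%g.
have gE : g = (u * (swap * b))%g.
  by rewrite /b -(mulgA swap) (mulgA swap swap) swapK mul1g mulVKg.
rewrite gE 2!rep_actM (triv b) ?Sx ?Ix //.
  rewrite /b !gpredM ?gpredV ?swap_maxcompact //.
  by have /and4P[] := Iu.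
have uV : u^-1%g = unip (- (g 0 0 / g 1 0)).
  apply: mulg1_eq; rewrite gl2M // -gl2_1.
  by congr gl2; ring.
rewrite (_ : b 1 0 = 0) ?rpred0 //.
have [e1 e2 e3 e4] := gl2_entries swap_det.
have [f1 f2 f3 f4] := gl2_entries (unip_det (- (g 0 0 / g 1 0))).
by rewrite /b uV !gl_mulE !(e1, e2, e3, e4, f1, f2, f3, f4); field.
Qed.
End Elements.

(** * Invariant orbit sums *)

Section OrbitSums.
Variables (p : nat) (p_pr : prime p) (F : fieldExtType (padic p_pr)).
Variables (w : integers F) (hw : uniformizer w).
Variables (Fq : finFieldType) (red : {rmorphism integers F -> Fq}).
Hypothesis hred : residue_map red.
Variables (t : Fq -> integers F) (ht : teichmuller red t).
Variable k : fieldType.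
Local Notation O := (@integral_pred p p_pr F).
Local Notation mult := (multiple w).
Local Notation I1 := (pro_p_iwahori w).
Local Notation u_ x := (unip (t x%R : F)%R).

Lemma teichmuller0 : (t 0 : F) = 0.
Proof.
have [tM tK] := ht; apply/eqP; apply: contraT => t0.
have /(congr1 val) /= := tM 0 0; rewrite mulr0 => /eqP.
rewrite -{1}[int_val _]mulr1 (inj_eq (mulfI t0)) => /eqP t1.
have /eqP := tK 0; rewrite (_ : t 0 = 1) ?rmorph1 ?oner_eq0 //.
exact/val_inj.
Qed.

Lemma teichmullerV x : x != 0 -> (t x : F) != 0 /\ (t x^-1 : F) = (t x : F)^-1.
Proof.
move=> x0; have [tM tK] := ht.
have tn y : y != 0 -> (t y : F) != 0.
  move=> y0; apply/eqP => ty; have := tK y.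
  rewrite (_ : t y = 0); last exact/val_inj.
  by rewrite rmorph0 => yE; rewrite -yE eqxx in y0.
split; first exact: tn.
have t1 : (t 1 : F) = 1.
  have /(congr1 val) /= /eqP := tM 1 1; rewrite mulr1.
  by rewrite -{1}[int_val _]mulr1 (inj_eq (mulfI (tn _ (oner_neq0 _)))) => /eqP <-.
have /(congr1 val) /= := tM x x^-1; rewrite mulfV // t1 => E.
by rewrite -[LHS](mulKf (tn _ x0)) -E mulr1.
Qed.

Lemma red_eq_multiple (x y : integers F) : red x = red y -> (x : F) - (y : F) \in mult.
Proof.
move=> xy; have : red (x - y) = 0 by rewrite rmorphB xy subrr.
by move=> /(hred.2 _).1 /(hw.2 _).1 [z /(congr1 val) /= ->]; apply/multiple_w/(valP z).
Qed.

(** The u_x represent the cosets in I(1) of the subgroup of matrices that are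
    lower triangular modulo w, and these cosets are told apart by the residue of
    the upper right entry; mu is this residue for h. *)
Lemma unip_shift h : h \in I1 -> exists mu : Fq, forall x, exists2 h',
  h' \in I1 /\ h' 0 1 \in mult & (h * u_ x = u_ (x + mu) * h')%g.
Proof.
move=> Ih; have [ma Ob mc md] := iwahori_entries Ih.
pose b := Integers Ob; exists (red b) => x.
pose y : F := t (x + red b).
have Oy : y \in O by exact: valP.
have Ox : (t x : F) \in O by exact: valP.
exists (unip (- y) * h * u_ x)%g; last first.
  rewrite !mulgA gl2M ?unip_det // (_ : gl2 _ _ _ _ = 1%g) ?mul1g //.
  by rewrite -gl2_1; congr gl2; rewrite -?/y; ring.
split; first by rewrite !gpredM // (unip_iwahori hw) ?rpredN.
have [e1 e2 e3 e4] := gl2_entries (unip_det (- y)).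
have [f1 f2 f3 f4] := gl2_entries (unip_det (t x : F)).
rewrite !gl_mulE !(e1, e2, e3, e4, f1, f2, f3, f4).
rewrite (_ : _ + _ = (h 0 0 - 1) * (t x : F) - y * (t x : F) * h 1 0 +
  (((t x + b : integers F) : F) - y) - y * (h 1 1 - 1)); last by rewrite /=; ring.
apply: rpredB; last exact: multipleMr.
apply: rpredD; last by apply: red_eq_multiple; rewrite rmorphD ht.2 ht.2.
by apply: rpredB; [apply: multipleMl | apply/multipleMr/mc/rpredM].
Qed.

Local Notation C := (cind k (I1Z w)).

Lemma cind_invariant (f : C) :
  (forall h, h \in I1 -> rep_act C h f = f) -> f \in invariants C (I1Z w).
Proof.
move=> If; apply/invariantsP => _ /asboolP[h [z [Ih Zz ->]]].
by rewrite rep_actM (cind_center f Zz) If.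
Qed.

Lemma normalizer_invariant y : (forall h, h \in I1 -> (y^-1 * h * y)%g \in I1) ->
  bracket k (I1Z w) y \in invariants C (I1Z w).
Proof.
move=> Ny; apply: cind_invariant => h Ih; rewrite bracket_act.
rewrite -[RHS](@bracketMr _ _ _ _ (y^-1 * h * y)%g) ?(sub_I1Z (w := w)) ?Ny //.
by rewrite -!mulgA mulVKg.
Qed.

(** The hypothesis says that I(1) permutes the cosets u_x y I(1) in the way it
    permutes the residues x. *)
Lemma orbit_sum_invariant y :
    (forall h, h \in I1 -> h 0 1 \in mult -> (y^-1 * h * y)%g \in I1) ->
  \sum_(x : Fq) bracket k (I1Z w) (u_ x * y)%g \in invariants C (I1Z w).
Proof.
move=> Ny; apply: cind_invariant => h Ih; have [mu muP] := unip_shift Ih.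
rewrite linear_sum [RHS](reindex_inj (addIr mu)) /=; apply: eq_bigr => x _.
have [h' [Ih' mh'] hE] := muP x.
rewrite bracket_act mulgA hE.
rewrite -[RHS](@bracketMr _ _ _ _ (y^-1 * h' * y)%g) ?(sub_I1Z (w := w)) ?Ny //.
by rewrite -!mulgA mulVKg.
Qed.

(** Compare the relation with its image under s.  In the image the term l = 0 is
    x, and the term l != 0 is u_(1/l) s x because s u_l s = (1 0; l 1) is
    u_(1/l) s (l 1; 0 -1/l) and the upper triangular factor fixes x; so the two
    relations differ only in that x replaces s x. *)
Lemma swap_fixes (V : representation k (GL2 F)) (x : V) :
    (forall h, h \in I1 -> rep_act V h x = x) ->
    (forall a d, a != 0 -> d != 0 -> a \in O -> d \in O ->
       a^-1 \in O -> d^-1 \in O ->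
       rep_act V (diag a d) x = x) ->
    \sum_(l : Fq) rep_act V (u_ l * swap F)%g x = 0 ->
  rep_act V (swap F) x = x.
Proof.
move=> Ix Dx Sx; pose s := swap F.
have u0 : u_ 0 = 1%g by rewrite /unip teichmuller0 gl2_1.
have swap_unip l : l != 0 ->
    rep_act V (s * (u_ l * s))%g x = rep_act V (u_ l^-1 * s)%g x.
  move=> l0; have [t0 tV] := teichmullerV l0.
  have Ot : (t l : F) \in O by exact: valP.
  have OtV : (t l : F)^-1 \in O by rewrite -tV; exact: valP.
  have Nt0 : - (t l : F)^-1 != 0 by rewrite oppr_eq0 invr_eq0.
  have -> : (s * (u_ l * s) =
      u_ l^-1 * s * (diag (t l : F) (- (t l : F)^-1) * unip (t l : F)^-1))%g.
    have Du (y : F) : 1 * 1 - y * 0 != 0 by exact: unip_det.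
    have Ds : 0 * 0 - 1 * 1 != 0 :> F by exact: swap_det.
    have [E1 E2] : (u_ l * s)%g = gl2 (t l : F) 1 1 0 /\
        (u_ l^-1 * s)%g = gl2 (t l : F)^-1 1 1 0.
      by rewrite tV; split; rewrite gl2M ?Du ?Ds //; congr gl2; ring.
    rewrite E1 E2 (gl2M (diag_det t0 Nt0) (Du _)).
    have D1 (y : F) : y * 0 - 1 * 1 != 0.
      by rewrite mulr0 sub0r mulr1 oppr_eq0 oner_eq0.
    rewrite [RHS]gl2M ?D1 ?[LHS]gl2M ?D1 ?Ds //; first by congr gl2; field.
    rewrite (_ : _ - _ = -1) ?oppr_eq0 ?oner_eq0 //; by field.
  set d := diag _ _; set v := unip (t l : F)^-1.
  have vx : rep_act V v x = x by apply/Ix/(unip_iwahori hw).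
  have dx : rep_act V d x = x by apply: Dx; rewrite ?invrN ?invrK ?rpredN.
  by rewrite (rep_actM _ (d * v)%g) (rep_actM d v) vx dx.
have := congr1 (rep_act V s) Sx; rewrite linear_sum linear0.
rewrite (bigD1 0) //= -rep_actM u0 mul1g swapK rep_act1.
rewrite (eq_bigr (fun l => rep_act V (u_ l^-1 * s)%g x)); last first.
  by move=> l l0; rewrite -rep_actM swap_unip.
move=> E; move: Sx; rewrite (reindex_inj invr_inj) (bigD1 0) //= invr0 u0 mul1g.
by move=> E'; apply: (addIr _ (etrans E' (esym E))).
Qed.
End OrbitSums.

(** * The splitting *)

Section Splitting.
Variables (p : nat) (p_pr : prime p) (F : fieldExtType (padic p_pr)).
Variables (w : integers F) (hw : uniformizer w).
Variables (Fq : finFieldType) (red : {rmorphism integers F -> Fq}).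
Hypothesis hred : residue_map red.
Variables (t : Fq -> integers F) (ht : teichmuller red t).
Variable k : fieldType.
Hypothesis q0 : #|Fq|%:R = 0 :> k.
Variables (T : rep_hom (cind k (KZ F)) (cind k (KZ F))).
Hypothesis hT : spherical_hecke w t T.
Local Notation O := (@integral_pred p p_pr F).
Local Notation I1 := (pro_p_iwahori w).
Local Notation u_ x := (unip (t x%R : F)%R).
Local Notation C := (cind k (I1Z w)).
Local Notation P := (pi0 T).
Local Notation X := (pi0_I1_tensor w T).
Local Notation one := (bracket k (I1Z w) 1%g).

Definition tens (v : pi0_I1 w T) (f : C) : X :=
  pure_tensor (@pi0_I1_act p p_pr F k w T)
    (@cind_act_equivariant p p_pr F k w) v f.

Definition pi0_class (g : GL2 F) : P := quot_pi (image T) (bracket k (KZ F) g).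

Lemma pi0_class_act g h : rep_act P g (pi0_class h) = pi0_class (g * h)%g.
Proof. by rewrite [LHS]quot_mapE bracket_act. Qed.

Lemma pi0_classMr g h : h \in KZ F -> pi0_class (g * h)%g = pi0_class g.
Proof. by move=> Kh; rewrite /pi0_class bracketMr. Qed.

Lemma unip_diag_w x : (unip x * diag (w : F) 1%R)%g = gl2 (w : F) x 0 1.
Proof.
rewrite gl2M ?unip_det ?diag_det ?oner_eq0 ?(uniformizer_neq0 hw) //.
by congr gl2; ring.
Qed.

(** The relation T [1, 1] = 0 in the quotient. *)
Lemma pi0_class_hecke :
  \sum_(x : Fq) pi0_class (u_ x * diag (w : F) 1%R)%g =
    - pi0_class (diag 1 (w : F)).
Proof.
apply/eqP; rewrite -addr_eq0 /pi0_class -linear_sum -linearD.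
rewrite -(linear0 (quot_pi (image T))); apply/eqP/quot_piP; rewrite subr0.
apply/asboolP; exists (bracket k (KZ F) 1%g); rewrite hT mul1g.
under [in LHS]eq_bigr do rewrite unip_diag_w.
by under [in RHS]eq_bigr do rewrite mul1g.
Qed.

Lemma K_KZ g : g \in @maxcompact p p_pr F -> g \in KZ F.
Proof. exact: sub_mul_center. Qed.

Lemma I1_KZ g : g \in I1 -> g \in KZ F.
Proof. by move=> /and4P[Kg _ _ _]; apply: K_KZ. Qed.

Lemma normalizer_pi0_class g : (forall h, h \in I1 -> (g^-1 * h * g)%g \in I1) ->
  pi0_class g \in invariants P (I1 : groupClosed _).
Proof.
move=> Ng; apply/invariantsP => h Ih; rewrite pi0_class_act.
by rewrite -[RHS](@pi0_classMr _ (g^-1 * h * g)%g) ?I1_KZ ?Ng // -!mulgA mulVKg.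
Qed.

Lemma pi0_class1_invariant : pi0_class 1%g \in invariants P (I1 : groupClosed _).
Proof. by apply: normalizer_pi0_class => h; rewrite invg1 mul1g mulg1. Qed.

Definition v0 : pi0_I1 w T := Subspace pi0_class1_invariant.
Definition v1 : pi0_I1 w T := Subspace (normalizer_pi0_class (conj_atkin hw)).
Definition generator : X := tens v0 one.

Lemma generator_act g : rep_act X g generator = tens v0 (bracket k (I1Z w) g).
Proof. by rewrite [LHS]pure_tensor_act bracket_act mulg1. Qed.

Lemma frob_v0 g : frob (val v0) (bracket k (I1Z w) g) = pi0_class g.
Proof.
rewrite frob_bracket ?pi0_class_act ?mulg1 //.
exact/pi0_invariants/pi0_class1_invariant.
Qed.

Lemma tens_v0 (f : C) (v : pi0_I1 w T) :
    f \in invariants C (I1Z w) -> val v = frob (val v0) f ->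
  tens v0 f = tens v one.
Proof. exact: pure_tensor_hecke. Qed.

Lemma generator_I1 h : h \in I1 -> rep_act X h generator = generator.
Proof.
move=> Ih; rewrite generator_act -(mul1g h) bracketMr //.
exact: (sub_I1Z (w := w)).
Qed.

(** Diagonal matrices with unit entries normalize I(1), hence act on [1, 1] as
    Hecke operators, and these fix v0. *)
Lemma generator_diag a d : a != 0 -> d != 0 -> a \in O -> d \in O ->
  a^-1 \in O -> d^-1 \in O -> rep_act X (diag a d) generator = generator.
Proof.
move=> a0 d0 Oa Od Oa' Od'; rewrite generator_act; apply: tens_v0.
  by apply: normalizer_invariant => h; apply: conj_diag_unit.
rewrite frob_v0 /= -(mul1g (diag a d)) pi0_classMr //; apply: K_KZ.
have [e1 e2 e3 e4] := gl2_entries (diag_det a0 d0).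
apply: maxcompact_mem; first by rewrite e1 e2 e3 e4 rpred0.
by rewrite det_mx2 e1 e2 e3 e4 mulr0 subr0 invfM rpredM.
Qed.

(** The Hecke operator that maps [1, 1] to the sum of the [u_l s, 1] multiplies
    v0 by the number q of terms, as K fixes v0, and q = 0 in k. *)
Lemma generator_orbit_swap :
  \sum_(x : Fq) rep_act X (u_ x * swap F)%g generator = 0.
Proof.
rewrite (eq_bigr _ (fun x _ => generator_act _)) -[LHS]pure_tensor_sum.
rewrite -[LHS]/(tens _ _) (@tens_v0 _ 0).
- by rewrite /tens -(scale0r 0) pure_tensorZl scale0r.
- by apply: (orbit_sum_invariant hw hred ht) => h; apply: (conj_swap hw).
rewrite linear_sum /= (eq_bigr (fun=> pi0_class 1%g)).
  by rewrite sumr_const -scaler_nat q0 scale0r.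
move=> x _; rewrite frob_v0 -(mul1g (_ * _)%g) pi0_classMr //.
rewrite gpredM ?(K_KZ (swap_maxcompact _)) //; apply: I1_KZ.
by apply: (unip_iwahori hw); exact: valP.
Qed.

Lemma generator_K g :
  g \in @maxcompact p p_pr F -> rep_act X g generator = generator.
Proof.
apply: (maxcompact_fixes hw); [exact: generator_I1|exact: generator_diag|].
apply: (swap_fixes hw ht); [exact: generator_I1|exact: generator_diag|].
exact: generator_orbit_swap.
Qed.

Lemma generator_KZ : generator \in invariants X (KZ F).
Proof.
apply/invariantsP => _ /asboolP[h [z [Kh Zz ->]]].
have Zx : rep_act X z generator = generator.
  by rewrite [LHS]pure_tensor_act cind_center.
by rewrite rep_actM (congr1 (rep_act X h) Zx) generator_K.
Qed.

(** The Hecke operator that maps [1, 1] to the sum of the [u_l diag(w, 1), 1]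
    sends v0 to - diag(1, w) v0 by the relation of T.  The Hecke operator of the
    normalizing element diag(1, w) s turns this vector back into a translate of
    [1, 1]; the factor s disappears because it fixes both v0 and x. *)
Lemma generator_hecke :
  \sum_(x : Fq) rep_act X (u_ x * diag (w : F) 1%R)%g generator =
    - rep_act X (diag 1 (w : F)) generator.
Proof.
rewrite (eq_bigr _ (fun x _ => generator_act _)) -[LHS]pure_tensor_sum.
rewrite -[LHS]/(tens _ _) (@tens_v0 _ (-1 *: v1)).
- rewrite /tens pure_tensorZl scaleN1r; congr (- _).
  rewrite -[LHS](@tens_v0 (bracket k (I1Z w) (atkin w))).
  + by rewrite -generator_act /atkin rep_actM generator_K ?swap_maxcompact.
  + exact: normalizer_invariant (conj_atkin hw).
  + by rewrite frob_v0.
- by apply: (orbit_sum_invariant hw hred ht) => h; apply: (conj_w hw).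
rewrite linear_sum /= (eq_bigr _ (fun x _ => frob_v0 _)) pi0_class_hecke scaleN1r.
by rewrite /atkin pi0_classMr // K_KZ ?swap_maxcompact.
Qed.

Lemma pi0_splits : exists (i : rep_hom P X) (r : rep_hom X P), cancel i r.
Proof.
have [||L LE] := @rep_hom_of k _ (cind k (KZ F)) X (frob generator).
- exact: linearP.
- by move=> g f; rewrite frob_act // generator_KZ.
have Lb g : L (bracket k (KZ F) g) = rep_act X g generator.
  by rewrite LE frob_bracket // generator_KZ.
have [LT LTE] := rep_hom_comp L T.
have LT1 : LT (bracket k (KZ F) 1%g) = 0.
  rewrite LTE hT linearD linear_sum Lb mul1g.
  under eq_bigr do rewrite Lb mul1g -unip_diag_w.
  by rewrite generator_hecke addNr.
have LT0 f : LT f = 0 by rewrite -frob_unique LT1 frob0l.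
have [|i iE] := quotient_lift (@image_stable _ _ _ _ T) (f := L).
  by move=> _ /asboolP[f ->]; rewrite -LTE LT0.
have [r rE] := tensor_counit (sub_I1Z (w := w)) (@pi0_invariants p p_pr F k w T)
  (@cind_act_equivariant p p_pr F k w).
have [rL rLE] := rep_hom_comp r L.
have [||pr prE] := @rep_hom_of k _ (cind k (KZ F)) P (quot_pi (image T)).
- exact: linearP.
- by move=> g f; rewrite [RHS]quot_mapE.
exists i, r => y; rewrite -(quot_piK y) iE -rLE -[RHS]prE.
apply: cind_hom_eq; rewrite rLE prE Lb rep_act1.
by rewrite [LHS]rE frob_v0.
Qed.
End Splitting.

Theorem theorem2p3 (p : nat) (p_pr : prime p) (F : fieldExtType (padic p_pr))
    (w : integers F) (hw : uniformizer w)
    (e : nat) (he : ramification_index w e)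
    (Fq : finFieldType) (red : {rmorphism integers F -> Fq})
    (hred : residue_map red)
    (f : nat) (hf : #|Fq| = (p ^ f)%N)
    (t : Fq -> integers F) (ht : teichmuller red t)
    (k : closedFieldType) (iota : {rmorphism 'F_p -> k})
    (hk : integralRange iota)
    (T : rep_hom (cind k (KZ F)) (cind k (KZ F))) (hT : spherical_hecke w t T) :
  (1 < e * f)%N -> (3 < p ^ f)%N ->
  exists M : representation k (GL2 F),
    rep_iso (pi0_I1_tensor w T) (rep_sum (pi0 T) M).
Proof.
move=> _ q3; have q0 : #|Fq|%:R = 0 :> k.
  case: f hf q3 => [|f] -> // _.
  by rewrite expnS natrM -(rmorph_nat iota) pchar_Fp_0 // rmorph0 mul0r.
have [i [r ir]] := pi0_splits hw hred ht q0 hT.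
exact: retract_iso ir.
Qed.
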